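(* Let $\Gamma$ be a finite group. If $\mathcal G_\Gamma$ denotes the ring over $\mathbb Z$ with basis $(K_\lambda)_{\lambda\in\mathcal P(\Gamma_* )}$ whose multiplication is given by $$K_\lambda K_\mu=\sum_{\|\nu\|=\|\lambda\|+\|\mu\|}a_{\lambda\mu}^\nu K_\nu ,$$ then the graded $R$-ring $\mathcal G_{R,\Gamma}$ associated to the filtered ring $\mathcal F_\Gamma$ is isomorphic to $R\otimes_\mathbb{Z}\mathcal G_\Gamma$.
   Context: $\Gamma_*$ is the set of conjugacy classes of $\Gamma$, and $c^0=\{1\}$. $S_n$ acts on $\Gamma^n$ by $\sigma(g_1,\dots,g_n)=(g_{\sigma^{-1}(1)},\dots,g_{\sigma^{-1}(n)})$, and $\Gamma_n=\Gamma^n\rtimes S_n$ with $(g,\sigma)(h,\tau)=(g\,\sigma(h),\sigma\tau)$. For $x=(g,\sigma)$ and a cycle $(i_1\cdots i_k)$ of $\sigma$ (fixed points are 1-cycles), the cycle-product is $g_{i_k}\cdots g_{i_1}$, well defined up to conjugacy. $\mathcal P(\Gamma_* )$ is the set of partition-valued functions on $\Gamma_*$; $\|\lambda\|=\sum_c|\lambda(c)|$, and $\ell$ denotes the number of parts of a partition. The type $\rho$ of $x\in\Gamma_n$: the number of parts of $\rho(c)$ equal to $i$ is the number of $i$-cycles of $\sigma$ with cycle-product in $c$. The modified type $\lambda$: $\lambda(c)=\rho(c)$ for $c\ne c^0$, and $\lambda(c^0)$ is obtained from $\rho(c^0)$ by subtracting 1 from every part (zeros discarded). $K_\lambda(n)\in\mathbb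 Z[\Gamma_n]$ is the sum of all elements of $\Gamma_n$ of modified type $\lambda$; it is nonzero iff $\|\lambda\|+\ell(\lambda(c^0))\le n$, and the nonzero ones form a $\mathbb Z$-basis of the center $R_\mathbb{Z}(\Gamma_n)$ of $\mathbb Z[\Gamma_n]$. Write $K_\lambda(n)K_\mu(n)=\sum_\nu a_{\lambda\mu}^\nu(n)K_\nu(n)$. There is a unique polynomial $f_{\lambda\mu}^\nu$ with $f_{\lambda\mu}^\nu(n)=a_{\lambda\mu}^\nu(n)$ for all $n\ge\|\nu\|+\ell(\nu(c^0))$; it vanishes unless $\|\nu\|\le\|\lambda\|+\|\mu\|$, and it is a constant, denoted $a_{\lambda\mu}^\nu\in\mathbb Z_{\ge0}$, when $\|\nu\|=\|\lambda\|+\|\mu\|$. $R$ is the subring of $\mathbb Q[t]$ of polynomials taking integer values at all integers. $\mathcal F_\Gamma$ is the commutative $R$-ring with $R$-basis $(K_\lambda)_{\lambda\in\mathcal P(\Gamma_* )}$ and multiplication $K_\lambda K_\mu=\sum_\nu f_{\lambda\mu}^\nu K_\nu$ (sum over $\nu$ with $\|\nu\|\le\|\lambda\|+\|\mu\|$). It is filtered by assigning degree $\|\lambda\|$ to $K_\lambda$, and $\mathcal G_{R,\Gamma}$ is its associated graded ring. *)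

(* Defs.v *)
From HB Require Import structures.
From mathcomp Require Import all_boot all_order all_fingroup all_algebra.
From mathcomp Require Import generic_quotient ring_quotient.
From mathcomp Require Import boolp classical_sets functions fsbigop.

Set Implicit Arguments.
Unset Strict Implicit.
Unset Printing Implicit Defensive.

Import GRing.Theory.
Local Open Scope ring_scope.
Local Open Scope quotient_scope.

Section Wreath.
Variables (gT : finGroupType) (n : nat).
Local Open Scope group_scope.

Definition wreath := ({ffun 'I_n -> gT} * 'S_n)%type.
HB.instance Definition _ := Finite.on wreath.

Definition perm_act (s : 'S_n) (g : {ffun 'I_n -> gT}) : {ffun 'I_n -> gT} :=
  [ffun i => g (s^-1 i)].

(* In the library (s * t) i = t (s i), so that the composite x.2 \o y.2 of the
   permutations is y.2 * x.2. *)
Definition wreath_mul (x y : wreath) : wreath :=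
  ([ffun i => x.1 i * perm_act x.2 y.1 i], y.2 * x.2).
Definition wreath_one : wreath := ([ffun=> 1], 1).
Definition wreath_inv (x : wreath) : wreath :=
  (perm_act x.2^-1 [ffun i => (x.1 i)^-1], x.2^-1).

Lemma wreath_mulA : associative wreath_mul.
Proof.
move=> x y z; congr pair; rewrite /= ?mulgA //.
by apply/ffunP=> i; rewrite !ffunE invMg permM mulgA.
Qed.

Lemma wreath_mul1 : left_id wreath_one wreath_mul.
Proof.
move=> [g s]; congr pair; rewrite /= ?mulg1 //.
by apply/ffunP=> i; rewrite !ffunE invg1 perm1 mul1g.
Qed.

Lemma wreath_mulV : left_inverse wreath_one wreath_inv wreath_mul.
Proof.
move=> [g s]; congr pair; rewrite /= ?mulgV //.
by apply/ffunP=> i; rewrite !ffunE mulVg.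
Qed.

HB.instance Definition _ :=
  Finite_isGroup.Build wreath wreath_mulA wreath_mul1 wreath_mulV.

End Wreath.

Section GroupRing.
Variable G : finGroupType.

Definition group_ring := {ffun G -> int}.
HB.instance Definition _ := GRing.Zmodule.on group_ring.

Definition gring_elt (x : G) : group_ring := [ffun y => (y == x)%:R].
Definition gring_mul (p q : group_ring) : group_ring :=
  [ffun x => \sum_y p y * q (y^-1 * x)%g].

Lemma gring_mulA : associative gring_mul.
Proof.
move=> p q r; apply/ffunP=> x; rewrite !ffunE.
under eq_bigr do rewrite ffunE mulr_sumr.
under [in RHS]eq_bigr do rewrite ffunE mulr_suml.
rewrite [RHS]exchange_big /=; apply: eq_bigr => y _.
rewrite [RHS](reindex_inj (mulgI y)) /=; apply: eq_bigr => z _.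
by rewrite mulKg invMg -!mulgA mulrA.
Qed.

Lemma gring_mul1l : left_id (gring_elt 1%g) gring_mul.
Proof.
move=> p; apply/ffunP=> x; rewrite ffunE (bigD1 1%g) //= big1 ?addr0.
  by rewrite ffunE eqxx mul1r invg1 mul1g.
by move=> y /negbTE y1; rewrite ffunE y1 mul0r.
Qed.

Lemma gring_mul1r : right_id (gring_elt 1%g) gring_mul.
Proof.
move=> p; apply/ffunP=> x; rewrite ffunE (bigD1 x) //= big1 ?addr0.
  by rewrite ffunE mulVg eqxx mulr1.
move=> y; rewrite ffunE => yx.
case: eqP => [/eqP|_]; last by rewrite mulr0.
by rewrite -eq_mulVg1 (negbTE yx).
Qed.

Lemma gring_mulDl : left_distributive gring_mul +%R.
Proof.
move=> p q r; apply/ffunP=> x; rewrite !ffunE -big_split /=.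
by apply: eq_bigr => y _; rewrite ffunE mulrDl.
Qed.

Lemma gring_mulDr : right_distributive gring_mul +%R.
Proof.
move=> p q r; apply/ffunP=> x; rewrite !ffunE -big_split /=.
by apply: eq_bigr => y _; rewrite ffunE mulrDr.
Qed.

Lemma gring_oner_neq0 : gring_elt 1%g != 0.
Proof. by apply/eqP => /ffunP/(_ 1%g); rewrite !ffunE eqxx. Qed.

HB.instance Definition _ := GRing.Zmodule_isNzRing.Build group_ring
  gring_mulA gring_mul1l gring_mul1r gring_mulDl gring_mulDr gring_oner_neq0.

End GroupRing.

Definition is_partition (s : seq nat) := sorted geq s && (0%N \notin s).
Definition partition := {s : seq nat | is_partition s}.

Lemma sort_partition (s : seq nat) :
  is_partition (sort geq [seq i <- s | i != 0%N]).
Proof.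
rewrite /is_partition mem_sort mem_filter eqxx andbT.
by apply: sort_sorted => i j; apply: leq_total.
Qed.

Definition partition_of (s : seq nat) : partition :=
  exist is_partition _ (sort_partition s).

Section Types.
Variable gT : finGroupType.

Definition conj_class := {c : {set gT} | c \in classes [set: gT]}.

Lemma class1_subproof : [set 1%g] \in classes [set: gT].
Proof. by rewrite classes1. Qed.
Definition c0 : conj_class :=
  exist (fun c => c \in classes [set: gT]) [set 1%g] class1_subproof.

Definition pvfun := {ffun conj_class -> partition}.
Implicit Types l m v : pvfun.

Definition pnorm l := (\sum_c sumn (val (l c)))%N.
(* The least n such that the class sum of l in degree n is nonzero *)
Definition pdegree l := (pnorm l + size (val (l c0)))%N.

Section FixedDegree.
Variable n : nat.
Implicit Type x : wreath gT n.

(* With i_1 = i, i_(j+1) = x.2 i_j and k the length of the cycle of i, this is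
   the product x.1 i_k * ... * x.1 i_1. *)
Definition cycle_product x (i : 'I_n) : gT :=
  let k := #|porbit x.2 i| in
  (\prod_(j < k) x.1 ((x.2 ^+ (k.-1 - j)) i))%g.

(* Changing the starting point of a cycle conjugates its cycle-product, so
   "exists" could be "forall". *)
Definition cycle_in x (C : {set 'I_n}) (c : conj_class) :=
  [exists i in C, cycle_product x i \in val c].

Definition wtype x : pvfun :=
  [ffun c => partition_of
     [seq #|pred_of_set C| | C <- enum (porbits x.2) & cycle_in x C c]].

Definition modified_type x : pvfun :=
  [ffun c => if c == c0 then partition_of [seq i.-1 | i <- val (wtype x c)]
             else wtype x c].

Definition class_sum l : group_ring (wreath gT n) :=
  \sum_(x | modified_type x == l) gring_elt x.

(* a is the family of coordinates of the product of class sums on the nonzero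
   class sums, extended by zero. *)
Definition is_expansion l m (a : pvfun -> int) :=
  (forall v, class_sum v = 0 -> a v = 0) /\
  class_sum l * class_sum m =
    \sum_(v \in [set v | class_sum v != 0]%classic) class_sum v *~ a v.

Definition struct_const l m : pvfun -> int :=
  xget (fun=> 0) [set a | is_expansion l m a]%classic.

End FixedDegree.
End Types.

Definition int_valued : {pred {poly rat}} :=
  [pred p : {poly rat} | `[< forall z : int, p.[z%:~R] \is a Num.int >]].

Lemma int_valued_subring : subring_closed int_valued.
Proof.
split=> [|p q /asboolP Hp /asboolP Hq|p q /asboolP Hp /asboolP Hq];
  apply/asboolP => z.
- by rewrite hornerC.
- by rewrite hornerD hornerN rpredB.
- by rewrite hornerM rpredM.
Qed.

HB.instance Definition _ :=
  GRing.isSubringClosed.Build {poly rat} int_valued int_valued_subring.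

Record int_poly := IntPoly {
  int_poly_val :> {poly rat};
  int_polyP : int_poly_val \in int_valued }.
HB.instance Definition _ := [isSub for int_poly_val].
HB.instance Definition _ := [Choice of int_poly by <:].
HB.instance Definition _ := [SubChoice_isSubComNzRing of int_poly by <:].

Section StructurePolynomials.
Variable gT : finGroupType.
Implicit Types l m v : pvfun gT.

Definition struct_poly l m v : int_poly :=
  xget 0 [set f : int_poly | forall n, (pdegree v <= n)%N ->
            (f : {poly rat}).[n%:R] = (struct_const n l m v)%:~R]%classic.

(* The value of the constant polynomial struct_poly l m v; it is only used when
   pnorm v = pnorm l + pnorm m. *)
Definition top_coef l m v : nat :=
  xget 0%N [set a : nat | struct_poly l m v = a%:R]%classic.

End StructurePolynomials.

Section Modules.
Variables (A : nzRingType) (V : lmodType A).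

Definition span (X : set V) : set V := [set v | exists s : seq (A * V),
  (forall ax, ax \in s -> X ax.2) /\ v = \sum_(ax <- s) ax.1 *: ax.2]%classic.

Definition is_basis (I : choiceType) (e : I -> V) :=
  (forall v, span (range e) v) /\
  (forall (s : seq I) (a : I -> A), uniq s ->
     \sum_(i <- s) a i *: e i = 0 -> forall i, i \in s -> a i = 0).

End Modules.

Record filtration (A : comNzRingType) (F : comAlgType A) := Filtration {
  fil :> nat -> set F;
  fil0 : forall d, fil d 0;
  filP : forall d a x y, fil d x -> fil d y -> fil d (a *: x + y);
  fil_le : forall d e x, (d <= e)%N -> fil d x -> fil e x;
  fil1 : fil 0%N 1;
  filM : forall d e x y, fil d x -> fil e y -> fil (d + e)%N (x * y);
  fil_exhaustive : forall x, exists d, fil d x }.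

(* The direct sum of the quotients fil d / fil d.-1 (with fil (-1) = 0) is
   constructed as the quotient of the direct sum of the fil d, viewed as the
   subring of the polynomials over F with coefficient of degree d in fil d, by
   the ideal which is the direct sum of the fil d.-1. *)
Section AssociatedGraded.
Variables (A : comNzRingType) (F : comAlgType A) (FF : filtration F).

Definition fil_pred (d : nat) : set F :=
  if d is d'.+1 then FF d' else [set 0]%classic.

Definition rees_pred : {pred {poly F}} :=
  [pred p : {poly F} | `[< forall d, FF d p`_d >]].

Lemma filZ d a x : FF d x -> FF d (a *: x).
Proof. by move=> Fx; rewrite -[_ *: _]addr0; apply: filP => //; apply: fil0. Qed.

Lemma filD d x y : FF d x -> FF d y -> FF d (x + y).
Proof. by move=> Fx Fy; rewrite -[x]scale1r; apply: filP. Qed.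

Lemma filB d x y : FF d x -> FF d y -> FF d (x - y).
Proof. by move=> Fx Fy; rewrite addrC -scaleN1r; apply: filP. Qed.

Lemma fil_sum d (I : Type) (r : seq I) (f : I -> F) :
  (forall i, FF d (f i)) -> FF d (\sum_(i <- r) f i).
Proof.
by move=> Ff; elim/big_rec: _ => [|i x _ Fx]; [apply: fil0|apply: filD].
Qed.

Lemma rees_subring : subring_closed rees_pred.
Proof.
split=> [|p q /asboolP Fp /asboolP Fq|p q /asboolP Fp /asboolP Fq];
  apply/asboolP => d.
- by rewrite coef1; case: d => [|d]; [apply: fil1|apply: fil0].
- by rewrite coefB; apply: filB.
- rewrite coefM; apply: fil_sum => i.
  by rewrite -{1}(subnKC (leq_ord i)); apply: filM.
Qed.

HB.instance Definition _ :=
  GRing.isSubringClosed.Build {poly F} rees_pred rees_subring.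

Record rees := Rees { rees_val :> {poly F}; reesP : rees_val \in rees_pred }.
HB.instance Definition _ := [isSub for rees_val].
HB.instance Definition _ := [Choice of rees by <:].
HB.instance Definition _ := [SubChoice_isSubComNzRing of rees by <:].

Definition graded_ideal : {pred rees} :=
  [pred p : rees | `[< forall d, fil_pred d (val p)`_d >]].

Lemma fil_predD d x y : fil_pred d x -> fil_pred d y -> fil_pred d (x + y).
Proof. by case: d => [|d] /=; [move=> -> ->; rewrite addr0|apply: filD]. Qed.

Lemma fil_predM d e x y :
  FF d x -> fil_pred e y -> fil_pred (d + e)%N (x * y).
Proof.
case: e => [|e] /= Fx; last by rewrite addnS; apply: filM.
move=> ->; rewrite mulr0 addn0.
by case: d Fx => [|d] Fx //=; apply: fil0.
Qed.

Lemma graded_ideal_closed : idealr_closed graded_ideal.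
Proof.
split=> [||p q r /asboolP Iq /asboolP Ir].
- apply/asboolP => d; rewrite raddf0 coef0.
  by case: d => [|d] //=; apply: fil0.
- apply/asboolP => /(_ 0%N); rewrite rmorph1 coef1 eqxx.
  by apply/eqP; rewrite oner_eq0.
- apply/asboolP => d; rewrite rmorphD rmorphM coefD.
  apply: fil_predD => //; rewrite coefM.
  elim/big_rec: _ => [|i x _ Fx]; first by case: (d) => [|d'] //=; apply: fil0.
  apply: fil_predD => //; rewrite -{1}(subnKC (leq_ord i)).
  by apply: fil_predM => //; have /asboolP := valP p; apply.
Qed.

HB.instance Definition _ := isIdealr.Build rees graded_ideal graded_ideal_closed.

Definition assoc_graded := {ideal_quot graded_ideal}.
HB.instance Definition _ := GRing.ComNzRing.on assoc_graded.

Lemma rees_const_subproof (a : A) : (a%:A)%:P \in rees_pred.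
Proof.
apply/asboolP => -[|d]; rewrite coefC /=; last exact: fil0.
by apply: filZ; apply: fil1.
Qed.
Definition rees_const (a : A) : rees := Rees (rees_const_subproof a).

Definition graded_scale (a : A) (x : assoc_graded) : assoc_graded :=
  \pi_assoc_graded (rees_const a) * x.

Lemma graded_scaleA a b x :
  graded_scale a (graded_scale b x) = graded_scale (a * b) x.
Proof.
rewrite /graded_scale mulrA -rmorphM; congr (\pi _ * x).
by apply: val_inj; rewrite rmorphM /= -polyCM -scalerAl mul1r scalerA.
Qed.

Lemma graded_scale1 : left_id 1 graded_scale.
Proof.
move=> x; rewrite /graded_scale.
have -> : rees_const 1 = 1 by apply: val_inj; rewrite rmorph1 /= scale1r.
by rewrite rmorph1 mul1r.
Qed.

Lemma graded_scaleDr : right_distributive graded_scale +%R.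
Proof. by move=> a x y; rewrite /graded_scale mulrDr. Qed.

Lemma graded_scaleDl x : {morph graded_scale^~ x : a b / a + b}.
Proof.
move=> a b; rewrite /graded_scale -mulrDl -rmorphD; congr (\pi _ * x).
by apply: val_inj; rewrite rmorphD /= scalerDl polyCD.
Qed.

HB.instance Definition _ := GRing.Zmodule_isLmodule.Build A assoc_graded
  graded_scaleA graded_scale1 graded_scaleDr graded_scaleDl.

Lemma graded_scaleAl a (x y : assoc_graded) : a *: (x * y) = (a *: x) * y.
Proof. exact: mulrA. Qed.

HB.instance Definition _ :=
  GRing.Lmodule_isLalgebra.Build A assoc_graded graded_scaleAl.
HB.instance Definition _ := GRing.Lalgebra_isComAlgebra.Build A assoc_graded.

Definition graded_component (d : nat) : set assoc_graded :=
  [set y | exists (p : rees) (x : F),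
     val p = x *: 'X^d /\ y = \pi_assoc_graded p]%classic.

End AssociatedGraded.

(* T, with tau a b in the role of a (x) b, is the A-ring A (x)_Z B. *)
Record is_tensor_ring (A : comNzRingType) (B : nzRingType) (T : algType A)
    (tau : A -> B -> T) : Prop := {
  tensorDl : forall b, {morph tau^~ b : a a' / a + a'};
  tensorDr : forall a, {morph tau a : b b' / b + b'};
  tensor_universal : forall (V : zmodType) (beta : A -> B -> V),
    (forall b, {morph beta^~ b : a a' / a + a'}) ->
    (forall a, {morph beta a : b b' / b + b'}) ->
    exists h : {additive T -> V}, (forall a b, h (tau a b) = beta a b) /\
      forall h' : {additive T -> V},
        (forall a b, h' (tau a b) = beta a b) -> h' =1 h;
  tensor1 : tau 1 1 = 1;
  tensorM : forall a a' b b', tau a b * tau a' b' = tau (a * a') (b * b');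
  tensorZ : forall a a' b, a *: tau a' b = tau (a * a') b }.

Section FarahatHigman.
Variable gT : finGroupType.
Local Open Scope classical_set_scope.

(* The sums below are finite, as there are finitely many v of given norm. *)
Definition is_FH_ring (F : comAlgType int_poly) (K : pvfun gT -> F) :=
  is_basis K /\
  forall l m, K l * K m =
    \sum_(v \in [set v | (pnorm v <= pnorm l + pnorm m)%N])
       struct_poly l m v *: K v.

Definition is_FH_filtration (F : comAlgType int_poly) (K : pvfun gT -> F)
    (FF : filtration F) :=
  forall d, FF d = span (K @` [set l | (pnorm l <= d)%N]).

Definition is_graded_FH_ring (G : algType int) (K : pvfun gT -> G) :=
  is_basis K /\
  forall l m, K l * K m =
    \sum_(v \in [set v | pnorm v = (pnorm l + pnorm m)%N])
       (top_coef l m v)%:Z *: K v.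

Definition graded_FH_component (G : algType int) (K : pvfun gT -> G) (d : nat) :
    set G :=
  span (K @` [set l | pnorm l = d]).

(* The grading of the base change induced by that of G *)
Definition tensor_component (G : algType int) (K : pvfun gT -> G)
    (T : algType int_poly) (tau : int_poly -> G -> T) (d : nat) : set T :=
  span [set x | exists a g, graded_FH_component K d g /\ x = tau a g].

End FarahatHigman.

(* Main.v *)
Require Import Defs.
From HB Require Import structures.
From mathcomp Require Import all_boot all_order all_fingroup all_algebra.
From mathcomp Require Import generic_quotient ring_quotient.
From mathcomp Require Import zify.
From mathcomp Require Import finmap.
From mathcomp Require Import boolp classical_sets functions cardinality fsbigop.

Set Implicit Arguments.
Unset Strict Implicit.
Unset Printing Implicit Defensive.

(** Let [k_l] be the class of [K l] in degree [pnorm l] of the associated graded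
    ring ([top_symbol]). As the filtration is given by the norms of the basis elements, the [k_l]
    form a basis of the associated graded ring ([top_symbol_basis]), and
    [k_l * k_m] is the sum of the [struct_poly l m v *: k_v] with
    [pnorm v = pnorm l + pnorm m]. Once these polynomials are known to be natural
    numbers, their constant values being the [top_coef l m v] ([top_coefP]), the
    integral span of the [k_l] is a ring with the structure constants of the graded
    ring over the integers, which gives its existence; and for each such ring, with
    basis [KG], the linear map sending [k_l] to [1 (x) KG l] is multiplicative
    and respects the gradings. It has an inverse by the universal property of the
    tensor product.

    It remains to see that a top structure polynomial is constant. Its value at a
    large [n] is 0 or the number of factorizations [x = y * z] with [y] and [z] of
    types [l] and [m], for any [x] of type [v]. So it suffices to bound this
    number independently of [n], because a polynomial which takes finitely many
    values at the large integers is constant. The bound follows if [y] moves no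
    index outside the support of [x], whose size is at most [2 * pnorm v]
    ([wsupp_mul], [card_wsupp]).

    To prove this, adjoin a zero to Gamma and let the wreath product act on the
    labellings of [n] indices by the [q] elements of the resulting set. An element
    [x] has [q ^ b] fixed labellings, where [b] is the number of cycles of [x] with
    trivial cycle-product, and [b] is [n] minus the norm of the type of [x]
    ([card_fixlab], [pnorm_balanced]). A reflection imposes one equation on
    labellings, which divides the number of labellings fixed by an element by at
    most [q]. Factoring [y] into reflections, one finds that the norm is
    subadditive and that, if the norms of [y] and [z] add up to that of [y * z],
    all labellings fixed by [y * z] are fixed by [y] ([card_fixlab_mul]). A
    labelling with a single nonzero label then shows that the support of [y] is
    contained in that of [y * z]. *)

Import GRing.Theory Num.Theory.
Local Open Scope ring_scope.
Local Open Scope quotient_scope.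

(** * Labellings fixed by elements of the wreath product *)

Lemma card_le_inj_prod (S T : finType) (D E : {set T}) (phi : T -> S * T) :
    {in D &, injective phi} -> (forall f, f \in D -> (phi f).2 \in E) ->
  (#|D| <= #|S| * #|E|)%N.
Proof.
move=> inj_phi DE; rewrite -(card_in_imset inj_phi) -cardsT -cardsX.
apply/subset_leq_card/fintype.subsetP => _ /imsetP[f Df ->].
by rewrite !inE; apply: DE.
Qed.

Section FixedConfigurations.
Variables (gT : finGroupType) (n : nat).
Local Open Scope group_scope.
Implicit Types (x y z r : wreath gT n) (f : {ffun 'I_n -> option gT}).

(** A labelling of the index set has values in Gamma with a zero adjoined; [None]
    is the zero, fixed by Gamma. *)
Definition label_mul (g : gT) : option gT -> option gT := omap (mulg g).

(** The action of the wreath product on labellings *)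
Definition label_act x f : {ffun 'I_n -> option gT} :=
  [ffun i => label_mul (x.1 i) (f (x.2^-1 i))].

Lemma label_mul1 o : label_mul 1 o = o.
Proof. by case: o => //= h; rewrite mul1g. Qed.

Lemma label_mulM g h o : label_mul (g * h) o = label_mul g (label_mul h o).
Proof. by case: o => //= u; rewrite mulgA. Qed.

Lemma label_actM x y f : label_act (x * y) f = label_act x (label_act y f).
Proof. by apply/ffunP=> i; rewrite !ffunE label_mulM invMg permM. Qed.

Lemma label_act1 f : label_act 1 f = f.
Proof. by apply/ffunP=> i; rewrite !ffunE label_mul1 invg1 perm1. Qed.

(** The labellings fixed by [x] *)
Definition fixlab x : {set {ffun 'I_n -> option gT}} :=
  [set f | label_act x f == f].

Lemma fixlabP x f :
  reflect (forall i, f (x.2 i) = label_mul (x.1 (x.2 i)) (f i)) (f \in fixlab x).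
Proof.
rewrite inE; apply: (iffP eqP) => [fx i | fx].
  by rewrite -{1}fx ffunE permK.
by apply/ffunP=> i; rewrite ffunE -{1}[i](permKV x.2) -fx permKV.
Qed.

Lemma fixlab_mul x y f : f \in fixlab x -> f \in fixlab y -> f \in fixlab (x * y).
Proof. by rewrite !inE label_actM => /eqP fx /eqP ->; apply/eqP. Qed.

Definition zero_labels : {ffun 'I_n -> option gT} := [ffun=> None].

Lemma fixlab0 x : zero_labels \in fixlab x.
Proof. by apply/fixlabP => i; rewrite !ffunE. Qed.

Lemma card_fixlab_gt0 x : (0 < #|fixlab x|)%N.
Proof. by apply/card_gt0P; exists zero_labels; apply: fixlab0. Qed.

(** The labelling equal to [f1] on [C] and to [f2] elsewhere *)
Definition glue (C : pred 'I_n) (f1 f2 : {ffun 'I_n -> option gT}) :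
  {ffun 'I_n -> option gT} := [ffun k => if C k then f1 k else f2 k].

Lemma fixlab_glue x i f1 f2 : f1 \in fixlab x -> f2 \in fixlab x ->
  glue (mem (porbit x.2 i)) f1 f2 \in fixlab x.
Proof.
move=> /fixlabP f1x /fixlabP f2x; apply/fixlabP => k; rewrite !ffunE /=.
have -> : (x.2 k \in porbit x.2 i) = (k \in porbit x.2 i).
  by rewrite -!eq_porbit_mem -(porbit_perm x.2 1 k) expg1.
by case: ifP.
Qed.

(** Right multiplication of the labels by [h]; it commutes with the action of the
    wreath product. *)
Definition label_rmul h f : {ffun 'I_n -> option gT} :=
  [ffun k => omap (mulg^~ h) (f k)].

Lemma fixlab_rmul x h f : f \in fixlab x -> label_rmul h f \in fixlab x.
Proof.
move=> /fixlabP fx; apply/fixlabP => k; rewrite !ffunE fx.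
by case: (f k) => //= u; rewrite mulgA.
Qed.

Lemma fixlab_agree x j k f1 f2 : f1 \in fixlab x -> f2 \in fixlab x ->
  f1 j = f2 j -> k \in porbit x.2 j -> f1 k = f2 k.
Proof.
move=> /fixlabP f1x /fixlabP f2x f12 /porbitP[m ->].
elim: m => [|m IHm]; first by rewrite !perm1.
by rewrite expgSr permM f1x f2x IHm.
Qed.

(** One more equation [f i = A (f j)] divides the number of fixed labellings by at
    most the number of labels. *)
Lemma card_fixlab_constraint z i j (A : option gT -> option gT) : A None = None ->
  (#|fixlab z| <= #|{: option gT}| *
     #|fixlab z :&: [set f : {ffun 'I_n -> option gT} | f i == A (f j)]|)%N.
Proof.
move=> A0.
(* If [i] is on the cycle of [j], or carries the label zero in all fixed
   labellings, put zeros on the cycle of [j] and remember the label of [j].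
   Otherwise the cycle of [i] can be relabelled so that the equation holds,
   remembering the label of [i]. *)
have [/fintype.existsP[f0 /and3P[zf0 f0i ij]] | zi0] :=
  boolP [exists f, [&& f \in fixlab z, f i != None & i \notin porbit z.2 j]];
  last first.
  apply: (@card_le_inj_prod _ _ _ _
    (fun f => (f j, glue (mem (porbit z.2 j)) zero_labels f))).
    move=> f f' zf zf' [ffj /ffunP eq_off]; apply/ffunP => k.
    have [zjk | zjk] := boolP (k \in porbit z.2 j).
      exact: fixlab_agree zf zf' ffj zjk.
    by have:= eq_off k; rewrite !ffunE /= (negbTE zjk).
  move=> f zf; rewrite inE fixlab_glue ?fixlab0 //= inE !ffunE /= porbit_id A0.
  case: ifP => // zji; apply: contraR zi0 => fi; apply/fintype.existsP; exists f.
  by rewrite zf fi zji.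
case f0iE: (f0 i) f0i => [a|//] _.
pose w f := if A (f j) is Some b then label_rmul (a^-1 * b) f0 else zero_labels.
have wi f : w f i = A (f j).
  by rewrite /w; case: (A _) => [b|]; rewrite ffunE // f0iE /= mulKVg.
have zw f : w f \in fixlab z.
  by rewrite /w; case: (A _) => [b|]; [apply: fixlab_rmul | apply: fixlab0].
apply: (@card_le_inj_prod _ _ _ _
    (fun f => (f i, glue (mem (porbit z.2 i)) (w f) f))).
  move=> f f' zf zf' [ffi /ffunP eq_off]; apply/ffunP => k.
  have [zik | zik] := boolP (k \in porbit z.2 i).
    exact: fixlab_agree zf zf' ffi zik.
  by have:= eq_off k; rewrite !ffunE /= (negbTE zik).
move=> f zf; rewrite inE fixlab_glue //= inE !ffunE /= porbit_id wi porbit_sym.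
by rewrite (negbTE ij).
Qed.

(** The indices that are not fixed points with trivial cycle-product *)
Definition wsupp x : {set 'I_n} := [set i | (x.2 i != i) || (x.1 i != 1)].

Lemma wsuppPn x i : reflect (x.2 i = i /\ x.1 i = 1) (i \notin wsupp x).
Proof. by rewrite inE negb_or !negbK; apply: (iffP andP) => -[/eqP ? /eqP]. Qed.

Lemma wsupp0 x : wsupp x = finset.set0 -> x = 1.
Proof.
move=> x0; have x1 i : x.2 i = i /\ x.1 i = 1 by apply/wsuppPn; rewrite x0 inE.
case: x x1 {x0} => g s /= x1; congr pair.
  by apply/ffunP => i; rewrite ffunE (x1 i).2.
by apply/permP => i; rewrite perm1 (x1 i).1.
Qed.

Lemma fixlab_update x i o f : i \notin wsupp x -> f \in fixlab x ->
  [ffun k => if k == i then o else f k] \in fixlab x.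
Proof.
move=> /wsuppPn[x2i x1i] /fixlabP fx; apply/fixlabP => k; rewrite !ffunE.
rewrite -{1}x2i (inj_eq perm_inj).
by have [-> | _] := eqVneq k i; rewrite ?fx // x2i x1i label_mul1.
Qed.

(** The supports are determined by the sets of fixed labellings: [i] is outside
    the support iff the labelling supported at [i] with label 1 is fixed. *)
Lemma sub_wsupp x y : fixlab x \subset fixlab y -> wsupp y \subset wsupp x.
Proof.
move=> /fintype.subsetP xy; apply/fintype.subsetP => i; apply: contraTT => xi.
have /xy/fixlabP/(_ i) := fixlab_update (Some 1) xi (fixlab0 x).
rewrite !ffunE eqxx; have [/= y2i [y1i] | //] := eqVneq (y.2 i) i.
by move: y1i; rewrite y2i mulg1 => y1i; apply/wsuppPn.
Qed.

Lemma wreath_mulVE y r i : ((y * r^-1).2 i = y.2 (r.2^-1 i)) *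
  ((y * r^-1).1 i = y.1 i * (r.1 (r.2 (y.2^-1 i)))^-1).
Proof.
by split; rewrite /= ?permM // !ffunE invgK.
Qed.

(** A nontrivial [y] is a product [y' * r], where the labellings fixed by the
    reflection [r] are the solutions of one equation and [y'] has at least [q]
    times as many fixed labellings as [y], with [q] the number of labels. Here [y']
    fixes an index [i] in the support of [y], so that the label of [i] is free. *)
Lemma reflection_factor y : y != 1 -> exists y' r i j A,
  [/\ y = y' * r, A None = None,
      fixlab r = [set f : {ffun 'I_n -> option gT} | f i == A (f j)]
    & (#|{: option gT}| * #|fixlab y| <= #|fixlab y'|)%N].
Proof.
move=> y1; have /set0Pn[i yi] : wsupp y != finset.set0.
  by apply: contra_neq y1; apply: wsupp0.
have factor r j A : A None = None ->
    fixlab r = [set f : {ffun 'I_n -> option gT} | f i == A (f j)] ->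
    fixlab y \subset fixlab r -> i \notin wsupp (y * r^-1) ->
    (forall f f', f \in fixlab y -> f' \in fixlab y ->
        (forall k, k != i -> f k = f' k) -> f i = f' i) ->
  exists y' r i j A,
  [/\ y = y' * r, A None = None,
      fixlab r = [set f : {ffun 'I_n -> option gT} | f i == A (f j)]
    & (#|{: option gT}| * #|fixlab y| <= #|fixlab y'|)%N].
  move=> A0 fixr yr yri off_i; exists (y * r^-1), r, i, j, A.
  split=> //; first by rewrite mulgKV.
  rewrite -cardsT -cardsX.
  pose phi (of_ : option gT * {ffun 'I_n -> option gT}) :
    {ffun 'I_n -> option gT} := [ffun k => if k == i then of_.1 else of_.2 k].
  rewrite -(card_in_imset (f := phi)); last first.
    move=> [o f] [o' f'] /setXP[_ fy] /setXP[_ f'y] /ffunP eq_phi.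
    have off k : k != i -> f k = f' k.
      by move=> /negbTE ki; have:= eq_phi k; rewrite !ffunE ki.
    congr pair; first by have:= eq_phi i; rewrite !ffunE eqxx.
    apply/ffunP => k; have [-> | /off//] := eqVneq k i; exact: off_i.
  apply/subset_leq_card/fintype.subsetP => _ /imsetP[[o f] /setXP[_ fy] ->].
  apply: fixlab_update => //=; apply: fixlab_mul => //.
  have := fintype.subsetP yr f fy; rewrite !inE => /eqP {1}<-.
  by rewrite -label_actM mulVg label_act1.
(* If [i] is a fixed point, [r] multiplies its label by [y.1 i]; otherwise [r]
   exchanges [i] with its predecessor [j]. *)
have [y2i | y2i] := eqVneq (y.2 i) i.
  have y1i : y.1 i != 1 by move: yi; rewrite inE y2i eqxx.
  pose r : wreath gT n := ([ffun k => if k == i then y.1 i else 1], 1).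
  have fixed0 o : o = label_mul (y.1 i) o -> o = None.
    case: o => //= u [uE]; case/negP: y1i.
    by rewrite -(mulgK u (y.1 i)) -uE mulgV.
  have yi0 f : f \in fixlab y -> f i = None.
    by move=> /fixlabP/(_ i); rewrite y2i; apply: fixed0.
  have fixr : fixlab r = [set f : {ffun 'I_n -> option gT} | f i == None].
    apply/setP => f; apply/fixlabP/idP => [/(_ i) | ]; rewrite !inE.
      by rewrite /= perm1 ffunE eqxx => /fixed0 ->.
    move=> /eqP fi k; rewrite /= perm1 ffunE; have [-> | _] := eqVneq k i.
      by rewrite fi.
    by rewrite label_mul1.
  apply: (factor r i (fun=> None)) => //.
  - by rewrite fixr; apply/fintype.subsetP => f /yi0; rewrite inE => ->.
  - apply/wsuppPn; rewrite !wreath_mulVE /= invg1 !perm1 y2i; split=> //.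
    have -> : y.2^-1 i = i by rewrite -{1}y2i permK.
    by rewrite ffunE eqxx mulgV.
  - by move=> f f' /yi0-> /yi0->.
pose j := y.2^-1 i; have y2j : y.2 j = i by rewrite permKV.
have ji : j != i by apply: contra_neq y2i => ji; rewrite -{1}ji.
pose g := y.1 i.
pose r : wreath gT n :=
  ([ffun k => if k == i then g else if k == j then g^-1 else 1], tperm i j).
have yi_ f : f \in fixlab y -> f i = label_mul g (f j).
  by move=> /fixlabP/(_ j); rewrite y2j.
have fixr :
    fixlab r = [set f : {ffun 'I_n -> option gT} | f i == label_mul g (f j)].
  apply/setP => f; apply/fixlabP/idP => [/(_ j) | ]; rewrite !inE.
    by rewrite /= tpermR ffunE eqxx => ->.
  move=> /eqP fi k; rewrite /= ffunE; case: tpermP => [-> | -> | ki kj].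
  - by rewrite (negbTE ji) eqxx fi -label_mulM mulVg label_mul1.
  - by rewrite eqxx.
  - by rewrite (introF eqP ki) (introF eqP kj) label_mul1.
apply: (factor r j (label_mul g)) => //.
- by rewrite fixr; apply/fintype.subsetP => f /yi_; rewrite inE => ->.
- apply/wsuppPn; rewrite !wreath_mulVE /= tpermV tpermL y2j; split=> //.
  by rewrite -/j tpermR ffunE eqxx mulgV.
- by move=> f f' /yi_-> /yi_-> off; rewrite off.
Qed.

(** With [q] labels, [#|fixlab x| = q ^ (n - norm x)] where the norm is that of the
    modified type (see [card_fixlab] and [pnorm_balanced]). So the inequality says that
    the norm is subadditive. The equality case holds because one factors [y] into
    reflections, each of which must then divide the number of fixed labellings
    exactly by [q]. *)
Lemma card_fixlab_mul y z :
  (#|fixlab y| * #|fixlab z| <= #|{: option gT}| ^ n * #|fixlab (y * z)%g|)%N /\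
  ((#|fixlab y| * #|fixlab z| = #|{: option gT}| ^ n * #|fixlab (y * z)%g|)%N ->
   fixlab (y * z) \subset fixlab y).
Proof.
set q := #|{: option gT}|.
have q2 : (1 < q)%N by rewrite /q card_option ltnS; apply/card_gt0P; exists 1.
have [m] := ubnP #|~: fixlab y|; elim: m y z => // m IHm y z.
have [-> _ | y1] := eqVneq y 1.
  have -> : fixlab 1 = [set: {ffun 'I_n -> option gT}].
    by apply/setP=> f; rewrite !inE label_act1 eqxx.
  by rewrite mul1g cardsT card_ffun card_ord leqnn finset.subsetT.
have [y' [r [i [j [A [yE A0 fixr cardy]]]]]] := reflection_factor y1.
rewrite ltnS => ym.
have y_gt0 := card_fixlab_gt0 y; have z_gt0 := card_fixlab_gt0 z.
have y'm : (#|~: fixlab y'| < m)%N.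
  apply: leq_trans ym; have := cardsC (fixlab y); 
  rewrite -(cardsC (fixlab y')) => e.
  nia.
have rz : (fixlab z :&: fixlab r) \subset fixlab (r * z).
  by apply/fintype.subsetP => f /setIP[fz fr]; apply: fixlab_mul.
have [IHle IHeq] := IHm y' (r * z) y'm.
have cardz : (#|fixlab z| <= q * #|fixlab z :&: fixlab r|)%N.
  by rewrite fixr; apply: card_fixlab_constraint.
have card_rz := subset_leq_card rz.
rewrite yE -mulgA -yE; split.
  apply: leq_trans IHle; nia.
move=> e.
have le1 : (#|fixlab y| * #|fixlab z| <=
            #|fixlab y| * (q * #|fixlab z :&: fixlab r|))%N.
  by rewrite leq_mul2l cardz orbT.
have le2 : (#|fixlab y| * (q * #|fixlab (r * z)%g|) <=
            #|fixlab y'| * #|fixlab (r * z)%g|)%N.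
  by rewrite mulnA [X in (X * _)%N]mulnC leq_mul2r cardy orbT.
have le3 : (#|fixlab y| * (q * #|fixlab z :&: fixlab r|) <=
            #|fixlab y| * (q * #|fixlab (r * z)%g|))%N.
  by rewrite !leq_mul2l card_rz !orbT.
have e1 : #|fixlab (r * z)| = #|fixlab z :&: fixlab r|.
  apply/eqP; rewrite -(eqn_pmul2l (ltnW q2)) -(eqn_pmul2l y_gt0) eqn_leq le3.
  by rewrite andbT; apply: leq_trans le2 (leq_trans IHle _); rewrite -e.
have e2 : (#|fixlab y'| * #|fixlab (r * z)%g| =
           q ^ n * #|fixlab (y' * (r * z))%g|)%N.
  apply/eqP; rewrite eqn_leq IHle -e (leq_trans le1) //.
  exact: leq_trans le3 le2.
have /eqP rzE : fixlab z :&: fixlab r == fixlab (r * z).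
  by rewrite eqEcard rz e1 leqnn.
apply/fintype.subsetP => f fyz; rewrite yE; apply: fixlab_mul.
  exact: (fintype.subsetP (IHeq e2)).
have rz_f : f \in fixlab (r * z).
  have fy' := fintype.subsetP (IHeq e2) f fyz.
  move: fyz fy'; rewrite !inE (label_actM y') => /eqP fyz /eqP fy'.
  have inj : injective (label_act y').
    apply: (can_inj (g := label_act y'^-1)) => h.
    by rewrite -label_actM mulVg label_act1.
  by apply/eqP/inj; rewrite fyz fy'.
by move: rz_f; rewrite -rzE => /setIP[].
Qed.

End FixedConfigurations.

(** * Cycles, norms and supports *)

Section Cycles.
Variables (gT : finGroupType) (n : nat).
Local Open Scope group_scope.
Implicit Types (x : wreath gT n) (f : {ffun 'I_n -> option gT}).

(** The product of the [x.1] along [k] steps of the cycle of [i]; it is the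
    cycle-product if [k] is the length of the cycle. *)
Definition path_product x (k : nat) (i : 'I_n) : gT :=
  \prod_(j < k) x.1 ((x.2 ^+ (k.-1 - j)) i).

Lemma path_productS x k i :
  path_product x k.+1 i = x.1 ((x.2 ^+ k) i) * path_product x k i.
Proof.
rewrite /path_product big_ord_recl /= subn0; congr (_ * _).
by apply: eq_bigr => j _; case: k j => [[]|k j] //; rewrite /bump /= add1n subSS.
Qed.

Lemma path_productSr x k i :
  path_product x k.+1 i = path_product x k (x.2 i) * x.1 i.
Proof.
elim: k => [|k IHk].
  by rewrite path_productS /path_product !big_ord0 mulg1 mul1g perm1.
by rewrite path_productS IHk [in RHS]path_productS mulgA expgS permM.
Qed.

Lemma porbit_step x i : porbit x.2 (x.2 i) = porbit x.2 i.
Proof. by rewrite -(porbit_perm x.2 1 i) expg1. Qed.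

Lemma cycle_product_step x i :
  cycle_product x (x.2 i) = cycle_product x i ^ (x.1 i)^-1.
Proof.
rewrite /cycle_product porbit_step -2!/(path_product x _ _).
apply: (mulIg (x.1 i)); rewrite -path_productSr path_productS conjgE invgK.
by rewrite -!mulgA mulVg mulg1 permX iter_porbit.
Qed.

Lemma cycle_product_conj x i j : j \in porbit x.2 i ->
  exists h, cycle_product x j = cycle_product x i ^ h.
Proof.
move=> /porbitP[m ->]; elim: m => [|m [h IHm]].
  by exists 1; rewrite conjg1 expg0 perm1.
exists (h * (x.1 ((x.2 ^+ m) i))^-1).
by rewrite expgSr permM cycle_product_step IHm conjgM.
Qed.

Lemma conj_class_of_subproof (g : gT) : g ^: [set: gT] \in classes [set: gT].
Proof. by rewrite mem_classes ?finset.in_setT. Qed.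

Definition conj_class_of (g : gT) : conj_class gT :=
  exist (fun c => c \in classes [set: gT]) _ (conj_class_of_subproof g).

Lemma mem_conj_class (c : conj_class gT) g : (g \in val c) = (c == conj_class_of g).
Proof.
case: c => c cc; rewrite -val_eqE /=; case/imsetP: (cc) => h _ ->.
apply/idP/eqP => [/class_eqP //| ->]; exact: class_refl.
Qed.

Lemma cycle_in_porbit x i c :
  cycle_in x (porbit x.2 i) c = (c == conj_class_of (cycle_product x i)).
Proof.
rewrite -mem_conj_class; apply/fintype.existsP/idP => [[j /andP[ij]] | ic].
  have [h ->] := cycle_product_conj ij.
  rewrite !mem_conj_class => /eqP ->; apply/eqP/val_inj => /=.
  by rewrite classGidl ?inE.
by exists i; rewrite porbit_id.
Qed.

Lemma cycle_in_c0 x i :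
  cycle_in x (porbit x.2 i) (c0 gT) = (cycle_product x i == 1).
Proof. by rewrite cycle_in_porbit -mem_conj_class /= inE. Qed.

Lemma fixlab_transport x f i k : f \in fixlab x ->
  f ((x.2 ^+ k) i) = label_mul (path_product x k (x.2 i)) (f i).
Proof.
move=> /fixlabP fx; elim: k => [|k IHk].
  by rewrite perm1 /path_product big_ord0 label_mul1.
by rewrite path_productS label_mulM -IHk -permM -expgS expgSr permM fx.
Qed.

Lemma expg_porbit_inj x i k m : (k < #|porbit x.2 i|)%N ->
  (m < #|porbit x.2 i|)%N -> (x.2 ^+ k) i = (x.2 ^+ m) i -> k = m.
Proof.
move=> lt_k lt_m e; apply/eqP; have := uniq_traject_porbit x.2 i.
move=> /(nth_uniq i) <-; rewrite ?size_traject //.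
by rewrite !nth_traject // -!permX e.
Qed.

(** A cycle with trivial cycle-product carries a fixed labelling which is nonzero
    exactly on this cycle. *)
Lemma fixlab_balanced x i : cycle_product x i = 1 -> exists f,
  [/\ f \in fixlab x, f i = Some 1 & forall k, k \notin porbit x.2 i -> f k = None].
Proof.
move=> xi1; set K := #|porbit x.2 i|.
have xi1' : path_product x K (x.2 i) = 1.
  have := cycle_product_step x i; rewrite xi1 conj1g => <-.
  by rewrite /cycle_product porbit_step.
pose f : {ffun 'I_n -> option gT} :=
  [ffun k => omap (fun m : 'I_K => path_product x m (x.2 i))
                  [pick m : 'I_K | (x.2 ^+ m) i == k]].
have fE m : (m < K)%N -> f ((x.2 ^+ m) i) = Some (path_product x m (x.2 i)).
  move=> lt_m; rewrite ffunE; case: pickP => [m' /eqP e | /(_ (Ordinal lt_m))].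
    by rewrite /= (expg_porbit_inj _ lt_m e).
  by rewrite eqxx.
have f0 k : k \notin porbit x.2 i -> f k = None.
  move=> ik; rewrite ffunE; case: pickP => // m /eqP e.
  by rewrite -e mem_porbit in ik.
have K_gt0 : (0 < K)%N by rewrite lt0n card_porbit_neq0.
have fi : f i = Some 1.
  by have := fE 0 K_gt0; rewrite perm1 /path_product big_ord0.
exists f; split=> //; apply/fixlabP => k.
have [ik | ik] := boolP (k \in porbit x.2 i); last first.
  by rewrite !f0 // -eq_porbit_mem porbit_step eq_porbit_mem.
have /trajectP[m lt_m ->] : k \in traject x.2 i K by rewrite -porbit_traject.
rewrite -permX -permM -expgSr fE //= [in x.1 _]expgS permM -path_productS.
move: lt_m; rewrite leq_eqVlt => /predU1P[mK | /fE//].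
by rewrite -/K mK permX iter_porbit xi1' fi.
Qed.

(** The cycles of [x] with trivial cycle-product *)
Definition balanced_cycles x : {set {set 'I_n}} :=
  [set C in porbits x.2 | cycle_in x C (c0 gT)].

Lemma mem_balanced x i :
  (porbit x.2 i \in balanced_cycles x) = (cycle_product x i == 1).
Proof. by rewrite inE imset_f // cycle_in_c0. Qed.

(** A fixed labelling is zero on the unbalanced cycles and is determined on a
    balanced cycle by the label of one of its elements, which is arbitrary. *)
Lemma card_fixlab x : #|fixlab x| = (#|{: option gT}| ^ #|balanced_cycles x|)%N.
Proof.
pose T := {C : {set 'I_n} | C \in balanced_cycles x}.
have repP (C : T) : exists i, (porbit x.2 i == val C) && (cycle_product x i == 1).
  case: C => C /= BC; have := BC; rewrite inE => /andP[/imsetP[i _ CE] _].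
  by exists i; rewrite CE eqxx -mem_balanced -CE.
pose rep C := xchoose (repP C).
have repE C : porbit x.2 (rep C) = val C /\ cycle_product x (rep C) = 1.
  by have /andP[/eqP ? /eqP] := xchooseP (repP C).
have -> : (#|{: option gT}| ^ #|balanced_cycles x| = #|{ffun T -> option gT}|)%N.
  by rewrite card_ffun card_sig.
apply/eqP; rewrite eqn_leq; apply/andP; split.
  pose phi f : {ffun T -> option gT} := [ffun C => f (rep C)].
  have inj_phi : {in fixlab x &, injective phi}.
    move=> f f' fx f'x /ffunP e; apply/ffunP => k.
    have [xk | xk] := boolP (porbit x.2 k \in balanced_cycles x).
      pose C : T := exist (fun C => C \in balanced_cycles x) _ xk.
      have := e C; rewrite !ffunE => eC; apply: fixlab_agree fx f'x eC _.
      by have [-> _] := repE C; rewrite porbit_id.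
    have fk0 f1 : f1 \in fixlab x -> f1 k = None.
      move=> f1x; have := fixlab_transport k #|porbit x.2 k| f1x.
      rewrite permX iter_porbit.
      have := cycle_product_step x k; rewrite {1}/cycle_product porbit_step.
      rewrite -/(path_product x _ _) => ->.
      case: (f1 k) => //= u [uE]; case/negP: xk; rewrite mem_balanced.
      rewrite -(conjg_eq1 _ (x.1 k)^-1).
      by rewrite -[X in X == _](mulgK u) -uE mulgV.
    by rewrite !fk0.
  by rewrite -(card_in_imset inj_phi) max_card.
have balP C : exists f, [/\ f \in fixlab x, f (rep C) = Some 1
    & forall k, k \notin porbit x.2 (rep C) -> f k = None].
  by apply: fixlab_balanced; have [] := repE C.
have [bal balE] := boolp.choice balP.
pose psi (h : {ffun T -> option gT}) : {ffun 'I_n -> option gT} :=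
  [ffun k => if insub (porbit x.2 k) is Some C then
     if h C is Some u then label_rmul u (bal C) k else None else None].
have psi_fix h : psi h \in fixlab x.
  apply/fixlabP => k; rewrite !ffunE porbit_step.
  case: insub => [C|] //; case: (h C) => [u|] //.
  by have [/(fixlab_rmul u)/fixlabP ->] := balE C.
have inj_psi : injective psi.
  move=> h h' /ffunP e; apply/ffunP => C.
  have psi_rep h1 : psi h1 (rep C) = h1 C.
    rewrite ffunE; have [-> _] := repE C; rewrite valK.
    case: (h1 C) => // u; rewrite ffunE; have [_ -> _] := balE C.
    by rewrite /= mul1g.
  by rewrite -!psi_rep e.
rewrite -cardsT -(card_imset _ inj_psi).
by apply/subset_leq_card/fintype.subsetP => _ /imsetP[h _ ->].
Qed.

End Cycles.

Lemma sumn_partition_of (s : seq nat) : sumn (val (partition_of s)) = sumn s.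
Proof.
rewrite /= (perm_sumn (permEl (perm_sort _ _))) !sumnE big_filter big_mkcond.
by apply: eq_bigr => i _; case: eqP => [->|].
Qed.

Lemma sumn_pred_partition_of (s : seq nat) :
  sumn [seq i.-1 | i <- val (partition_of s)] = sumn [seq i.-1 | i <- s].
Proof.
rewrite /= (perm_sumn (perm_map _ (permEl (perm_sort _ _)))) !sumnE !big_map.
rewrite big_filter big_mkcond; by apply: eq_bigr => i _; case: eqP => [->|].
Qed.

Section Norm.
Variables (gT : finGroupType) (n : nat).
Implicit Types x y z : wreath gT n.

(** The cycles with trivial cycle-product lose one unit of length in the modified
    type. *)
Lemma pnorm_modified_type x : pnorm (modified_type x) =
  (\sum_(C in porbits x.2) (#|C| - cycle_in x C (c0 gT)))%N.
Proof.
have typeE c : sumn (val (modified_type x c)) =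
    (\sum_(C in porbits x.2 | cycle_in x C c) (#|C| - (c == c0 gT)))%N.
  rewrite !ffunE; case: eqP => _;
    rewrite ?sumn_partition_of ?sumn_pred_partition_of.
    rewrite -map_comp sumnE big_map big_filter big_enum_cond /=.
    by apply: eq_bigr => C _; rewrite subn1.
  rewrite sumnE big_map big_filter big_enum_cond /=.
  by apply: eq_bigr => C _; rewrite subn0.
rewrite /pnorm; under eq_bigr do rewrite typeE.
rewrite (exchange_big_dep (mem (porbits x.2))) /=; last by move=> c C _ /andP[].
apply: eq_bigr => _ /imsetP[i _ ->].
under eq_bigl do rewrite cycle_in_porbit imset_f //=.
by rewrite big_pred1_eq cycle_in_porbit eq_sym.
Qed.

Lemma big_porbits x (F : 'I_n -> nat) :
  (\sum_i F i = \sum_(C in porbits x.2) \sum_(i in C) F i)%N.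
Proof.
rewrite (partition_big (porbit x.2) (mem (porbits x.2))) => [|i _] /=;
  last exact: imset_f.
apply: eq_bigr => _ /imsetP[i _ ->]; apply: eq_bigl => j.
by rewrite eq_porbit_mem.
Qed.

Lemma pnorm_balanced x :
  (pnorm (modified_type x) + #|balanced_cycles x| = n)%N.
Proof.
rewrite pnorm_modified_type -sum1dep_card.
rewrite [X in (_ + X)%N]big_mkcondr /= -big_split /=.
rewrite -[RHS]card_ord -sum1_card (big_porbits x).
apply: eq_bigr => _ /imsetP[i _ ->]; rewrite sum1_card.
have := card_porbit_neq0 x.2 i; case: (cycle_in _ _ _) => /=; lia.
Qed.

Lemma card_wsupp x : (#|wsupp x| <= 2 * pnorm (modified_type x))%N.
Proof.
rewrite pnorm_modified_type -sum1_card big_mkcond (big_porbits x) big_distrr /=.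
apply: leq_sum => _ /imsetP[i _ ->].
have : (\sum_(j in porbit x.2 i) (if j \in wsupp x then 1 else 0)
        <= \sum_(j in porbit x.2 i) 1)%N.
  by apply: leq_sum => j _; case: ifP.
rewrite cycle_in_c0 sum1_card; have := card_porbit_neq0 x.2 i.
have [xi1|_] := eqVneq (cycle_product x i) 1%g; last by rewrite /=; lia.
have [C1|] := eqVneq #|porbit x.2 i| 1%N; last by rewrite /=; lia.
move=> _ _; rewrite C1 /= muln0 leqn0 big1 // => j ij.
have /cards1P[i' C1'] : #|porbit x.2 i| == 1%N by rewrite C1.
have eq_i k : k \in porbit x.2 i -> k = i.
  by move: (porbit_id x.2 i); rewrite C1' !inE => /eqP -> /eqP.
rewrite (eq_i j ij) ifN //; apply/wsuppPn; split.
  by apply: eq_i; have := mem_porbit x.2 1 i; rewrite expg1.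
by move: xi1; rewrite /cycle_product C1 big_ord1 subnn perm1.
Qed.

(** If the norms add up then a factor does not move more indices than the
    product. *)
Lemma wsupp_mul y z :
    pnorm (modified_type (y * z)%g) =
      (pnorm (modified_type y) + pnorm (modified_type z))%N ->
  wsupp y \subset wsupp (y * z)%g.
Proof.
move=> norm_yz; apply: sub_wsupp; have [_ ->//] := card_fixlab_mul y z.
rewrite !card_fixlab -!expnD; congr (_ ^ _)%N.
have := pnorm_balanced y; have := pnorm_balanced z.
have := pnorm_balanced (y * z)%g; lia.
Qed.

Lemma card_sub_wsupp (S : {set 'I_n}) :
  (#|[set y : wreath gT n | wsupp y \subset S]|
     <= (#|gT| * #|S|) ^ #|S|)%N.
Proof.
have [-> | /set0Pn[i0 Si0]] := eqVneq S finset.set0.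
  rewrite cards0 expn0 -(cards1 (1%g : wreath gT n)).
  apply/subset_leq_card/fintype.subsetP => y.
  by rewrite !inE finset.subset0 => /eqP/wsupp0 ->.
pose phi (y : wreath gT n) : {ffun 'I_#|S| -> gT * 'I_#|S|} :=
  [ffun k => (y.1 (enum_val k), enum_rank_in Si0 (y.2 (enum_val k)))].
have inj_phi : {in [set y : wreath gT n | wsupp y \subset S] &, injective phi}.
  have outS (y : wreath gT n) i : wsupp y \subset S -> i \notin S ->
      y.2 i = i /\ y.1 i = 1%g.
    by move=> /fintype.subsetP yS iS; apply/wsuppPn; apply: contra iS => /yS.
  have stabS (y : wreath gT n) i : wsupp y \subset S -> i \in S -> y.2 i \in S.
    move=> yS; apply: contraTT => iS; have [e _] := outS y _ yS iS.
    by rewrite -(perm_inj e).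
  move=> y y'; rewrite !inE => yS y'S /ffunP e.
  have eqS i : i \in S -> y.1 i = y'.1 i /\ y.2 i = y'.2 i.
    move=> iS; have := e (enum_rank_in Si0 i); rewrite !ffunE enum_rankK_in //.
    case=> -> e2; split=> //.
    by apply: (can_in_inj (enum_rankK_in Si0)) => //; apply: stabS.
  have eqi i : y.1 i = y'.1 i /\ y.2 i = y'.2 i.
    have [/eqS // | iS] := boolP (i \in S).
    by have [-> ->] := outS y i yS iS; have [-> ->] := outS y' i y'S iS.
  case: y y' eqi {yS y'S e eqS} => g s [g' s'] /= eqi.
  by congr pair; [apply/ffunP|apply/permP] => i; have [] := eqi i.
rewrite -(card_in_imset inj_phi); apply: leq_trans (max_card _) _.
by rewrite card_ffun card_prod !card_ord.
Qed.

(** The number of factorizations of [x] into elements of given modified types whose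
    norms add up to that of [x] is bounded independently of [n], since the first
    factor is supported in the support of [x]. *)
Lemma card_factorizations l m x :
    pnorm (modified_type x) = (pnorm l + pnorm m)%N ->
  (#|[set y : wreath gT n | (modified_type y == l) &&
        (modified_type (y^-1 * x)%g == m)]|
   <= (#|gT| * (2 * (pnorm l + pnorm m))) ^ (2 * (pnorm l + pnorm m)))%N.
Proof.
move=> xlm; apply: (@leq_trans ((#|gT| * #|wsupp x|) ^ #|wsupp x|)%N).
  apply: leq_trans (card_sub_wsupp (wsupp x)).
  apply/subset_leq_card/fintype.subsetP => y.
  rewrite !inE => /andP[/eqP yl /eqP ym].
  have := @wsupp_mul y (y^-1 * x)%g; rewrite mulKVg; apply.
  by rewrite yl ym.
have := card_wsupp x; rewrite xlm => le_supp.
have gT_gt0 : (0 < #|gT|)%N by apply/card_gt0P; exists 1%g.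
case: (posnP #|wsupp x|) => [-> | supp_gt0].
  rewrite expn0; case: (posnP (2 * (pnorm l + pnorm m))) => [-> // | gt0].
  by rewrite expn_gt0 muln_gt0 gT_gt0 gt0.
apply: (@leq_trans ((#|gT| * (2 * (pnorm l + pnorm m))) ^ #|wsupp x|)%N).
  by rewrite leq_exp2r // leq_mul2l le_supp orbT.
by apply: leq_pexp2l => //; rewrite muln_gt0 gT_gt0; lia.
Qed.

End Norm.

(** * Top structure constants *)

Section StructureConstants.
Variable gT : finGroupType.
Implicit Types l m v : pvfun gT.

Lemma class_sumE n l (x : wreath gT n) :
  class_sum n l x = (modified_type x == l)%:R.
Proof.
rewrite sum_ffunE; under eq_bigr do rewrite ffunE.
have [xl | xl] := boolP (modified_type x == l).
  rewrite (bigD1 x) //= eqxx big1 ?addr0 // => y /andP[_].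
  by rewrite eq_sym => /negbTE ->.
apply: big1 => y yl; case: eqP => // xy; by rewrite xy yl in xl.
Qed.

Lemma class_sum_mulE n l m (x : wreath gT n) :
  (class_sum n l * class_sum n m) x =
  #|[set y : wreath gT n | (modified_type y == l) &&
        (modified_type (y^-1 * x)%g == m)]|%:R.
Proof.
rewrite ffunE -sum1dep_card natr_sum [RHS]big_mkcond /=; apply: eq_bigr => y _.
by rewrite !class_sumE; do 2![case: (_ == _)]; rewrite ?mulr0 ?mul0r ?mulr1.
Qed.

Lemma group_ring_mulrzE (G : finGroupType) (p : group_ring G) (a : int) y :
  (p *~ a) y = p y *~ a.
Proof.
by case: a => k; rewrite ?NegzE ?mulrNz ?[RHS]mulrNz ?ffunE -!pmulrn ffunMnE.
Qed.

Lemma class_sum_neq0 n v :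
  class_sum n v != 0 -> exists x : wreath gT n, modified_type x = v.
Proof.
move=> v0; apply/not_existsP => noX; case/eqP: v0.
by apply: big1 => x /eqP /noX.
Qed.

(** The coefficient at the modified type of [x] is the number of factorizations of
    [x]. *)
Lemma expansion_coef n l m a (x : wreath gT n) : is_expansion n l m a ->
  a (modified_type x) =
  #|[set y : wreath gT n | (modified_type y == l) &&
        (modified_type (y^-1 * x)%g == m)]|%:R.
Proof.
move=> [a0 /(congr1 (fun p : group_ring _ => p x))]; rewrite class_sum_mulE => ->.
set D := [set v | _]%classic.
have finD : finite_set D.
  apply: (@sub_finite_set _ _ (range (@modified_type gT n))).
    by move=> v /class_sum_neq0[y <-]; exists y.
  by apply: finite_image; apply: finite_finset.
rewrite fsbig_finite //= sum_ffunE.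
under eq_bigr do rewrite group_ring_mulrzE class_sumE.
have Dx : D (modified_type x).
  apply/eqP => /ffunP/(_ x); rewrite class_sumE eqxx ffunE => /eqP.
  by rewrite oner_eq0.
rewrite (bigD1_seq (modified_type x)) ?fset_uniq ?in_fset_set ?inE //=.
rewrite eqxx big1 ?addr0 ?intz // => v; rewrite eq_sym => /negbTE ->.
by rewrite mul0rz.
Qed.

(** This includes the degrees [n] for which the product of class sums would have no
    expansion or the class sum of [v] vanishes; the constant is then 0. *)
Lemma struct_const_bounded l m v : pnorm v = (pnorm l + pnorm m)%N ->
  exists B, forall n, exists2 k, (k <= B)%N & struct_const n l m v = k%:Z.
Proof.
move=> vlm; pose N := (2 * (pnorm l + pnorm m))%N.
exists ((#|gT| * N) ^ N)%N => n; rewrite /struct_const.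
case: xgetP => [a _ exp_a | _]; last by exists 0%N.
have [v0 | /class_sum_neq0[x xv]] := eqVneq (class_sum n v) 0.
  by exists 0%N => //; case: exp_a => ->.
exists #|[set y : wreath gT n | (modified_type y == l) &&
        (modified_type (y^-1 * x)%g == m)]|.
  by apply: card_factorizations; rewrite xv.
by rewrite -xv (expansion_coef x exp_a) natz.
Qed.

End StructureConstants.

(** A polynomial with finitely many values on the large integers is constant. *)
Lemma bounded_int_poly (f : {poly rat}) (d B : nat) :
    (forall n, (d <= n)%N -> exists2 k : nat, (k <= B)%N & f.[n%:R] = k%:R) ->
  exists k : nat, f = k%:R%:P.
Proof.
move=> fB; pose P := \prod_(k < B.+1) (f - (k%:R : rat)%:P).
(* The product of the [f - k] has infinitely many roots, so a factor vanishes. *)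
have /eqP/prodf_eq0[k _] : P = 0.
  apply: contraTeq isT => P0; pose rs := [seq n%:R : rat | n <- iota d (size P)].
  have : (size rs < size P)%N.
    apply: max_poly_roots => //.
      apply/allP => r /mapP[n]; rewrite mem_iota => /andP[/fB[k kB fn] _] -> {r}.
      rewrite /root horner_prod prodf_seq_eq0; apply/hasP.
      exists (Ordinal (n := B.+1) kB) => //.
      by rewrite /= hornerD hornerN hornerC fn subrr.
    rewrite ?uniq_rootsE map_inj_uniq ?iota_uniq // => a b /eqP.
    by rewrite eqr_nat => /eqP.
  by rewrite size_map size_iota ltnn.
by rewrite subr_eq0 => /eqP ->; exists k.
Qed.

(** The top structure polynomials are constants: their values at large integers are
    natural numbers and are bounded. *)
Lemma top_coefP (gT : finGroupType) (l m v : pvfun gT) :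
  pnorm v = (pnorm l + pnorm m)%N -> struct_poly l m v = (top_coef l m v)%:R.
Proof.
move=> vlm; suff ex_k : exists k : nat, struct_poly l m v = k%:R.
  have [k kE] := ex_k.
  by rewrite /top_coef; case: xgetP => [a _ -> // | /(_ k)].
(* By default [struct_poly l m v] is 0. *)
rewrite /struct_poly; case: xgetP => [f _ fE | _]; last by exists 0%N.
have [B cB] := struct_const_bounded vlm.
have [|k fk] := @bounded_int_poly (f : {poly rat}) (pdegree v) B.
  by move=> n vn; have [k kB ck] := cB n; exists k; rewrite // fE // ck -pmulrn.

exists k; apply: val_inj; rewrite [LHS]fk polyC_natr.
by rewrite [RHS](rmorph_nat (val : int_poly -> {poly rat})).
Qed.

(** * Bases *)

Section LinearCombinations.
Variables (A : nzRingType) (I : choiceType).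

(** Formal linear combinations are sequences of coefficients and indices, where an
    index may occur several times. *)
Definition lincomb (V : lmodType A) (e : I -> V) (t : seq (A * I)) : V :=
  \sum_(p <- t) p.1 *: e p.2.

Definition total_coef (t : seq (A * I)) (i : I) : A :=
  \sum_(p <- t | p.2 == i) p.1.

Lemma lincomb_cat (V : lmodType A) (e : I -> V) s t :
  lincomb e (s ++ t) = lincomb e s + lincomb e t.
Proof. exact: big_cat. Qed.

Lemma lincombZ (V : lmodType A) (e : I -> V) a t :
  lincomb e [seq (a * p.1, p.2) | p <- t] = a *: lincomb e t.
Proof.
by rewrite /lincomb big_map scaler_sumr; apply: eq_bigr => p _; rewrite scalerA.
Qed.

Lemma lincomb_uniq (V : lmodType A) (e : I -> V) t :
  lincomb e t = \sum_(i <- undup (map snd t)) total_coef t i *: e i.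
Proof.
under [RHS]eq_bigr do rewrite /total_coef scaler_suml.
rewrite (exchange_big_dep xpredT) //= [LHS]big_seq [RHS]big_seq.
apply: eq_bigr => p tp.
under eq_bigl do rewrite eq_sym.
rewrite (big_rem p.2) ?mem_undup ?map_f //= eqxx big_seq_cond big1 ?addr0 // => i.
by rewrite mem_rem_uniq ?undup_uniq // !inE => /andP[/andP[/negP]].
Qed.

Lemma basis_lincomb0 (V : lmodType A) (e : I -> V) t : is_basis e ->
  lincomb e t = 0 -> forall i, total_coef t i = 0.
Proof.
move=> [_ free_e]; rewrite lincomb_uniq => t0 i.
have [ti | ti] := boolP (i \in undup (map snd t)).
  exact: free_e (undup_uniq _) t0 i ti.
rewrite /total_coef big_seq_cond big1 // => p /andP[tp /eqP pi].
by rewrite mem_undup -pi map_f in ti.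
Qed.

Lemma total_coef_seq (s : seq I) (a : I -> A) i : uniq s -> i \in s ->
  total_coef [seq (a j, j) | j <- s] i = a i.
Proof.
move=> Us si; rewrite /total_coef big_map /= (big_rem i) //= eqxx.
rewrite big_seq_cond big1 ?addr0 // => j.
by rewrite mem_rem_uniq // !inE => /andP[/andP[/negP]].
Qed.

Lemma span_lincomb (V : lmodType A) (e : I -> V) (D : set I) v :
  Defs.span (e @` D)%classic v <->
  exists2 t : seq (A * I), (forall p, p \in t -> D p.2) & v = lincomb e t.
Proof.
split=> [[s [sD ->]] | [t tD ->]]; last first.
  exists [seq (p.1, e p.2) | p <- t]; split; last by rewrite /lincomb big_map.
  by move=> _ /mapP[p /tD Dp ->]; exists p.2.
elim: s sD => [|[a x] s IHs] sD; first by exists [::]; rewrite // /lincomb !big_nil.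
rewrite big_cons; have [|t tD ->] := IHs.
  by move=> p sp; apply: sD; rewrite inE sp orbT.
have [i Di /= eix] := sD (a, x) (mem_head _ _).
exists ((a, i) :: t); last by rewrite /lincomb big_cons /= eix.
by move=> p; rewrite inE => /orP[/eqP -> | /tD].
Qed.

Lemma basis_spanP (V : lmodType A) (e : I -> V) v : is_basis e ->
  exists t, v = lincomb e t.
Proof. by move=> [/(_ v)/span_lincomb[t _ ->] _]; exists t. Qed.

Lemma lincomb0 (V : lmodType A) (e : I -> V) t :
  (forall i, total_coef t i = 0) -> lincomb e t = 0.
Proof. by move=> t0; rewrite lincomb_uniq big1 // => i _; rewrite t0 scale0r. Qed.

(** The universal property of a basis *)
Lemma basis_extend (V W : lmodType A) (e : I -> V) (w : I -> W) :
  is_basis e -> exists h : {linear V -> W}, forall i, h (e i) = w i.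
Proof.
move=> Be; have [c cE] := boolp.choice (fun v => basis_spanP v Be).
have wd s t : lincomb e s = lincomb e t -> lincomb w s = lincomb w t.
  move=> est; apply/eqP; rewrite -subr_eq0 -scaleN1r -lincombZ -lincomb_cat.
  apply/eqP/lincomb0/(basis_lincomb0 Be).
  by rewrite lincomb_cat lincombZ scaleN1r est subrr.
pose h v := lincomb w (c v).
have h_lin : linear h.
  move=> a u v; rewrite /h -lincombZ -lincomb_cat; apply: wd.
  by rewrite lincomb_cat lincombZ -!cE.
pose hL : {linear V -> W} := HB.pack h (GRing.isLinear.Build A V W _ h h_lin).
exists hL => i; rewrite /= /h -[RHS]scale1r.
rewrite (wd (c (e i)) [:: (1, i)]); first by rewrite /lincomb big_seq1.
by rewrite -cE /lincomb big_seq1 scale1r.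
Qed.

End LinearCombinations.

Section TotalCoef.
Variables (A : nzRingType) (I : choiceType).
Implicit Types t : seq (A * I).

Lemma total_coef_cat t1 t2 i :
  total_coef (t1 ++ t2) i = total_coef t1 i + total_coef t2 i.
Proof. exact: big_cat. Qed.

Lemma total_coef_notin t i :
  (forall p, p \in t -> p.2 != i) -> total_coef t i = 0.
Proof.
move=> ti; rewrite /total_coef big_seq_cond big1 // => p /andP[/ti/negbTE ->].
by [].
Qed.

Lemma total_coef_filter (P : pred I) t i : P i ->
  total_coef [seq p <- t | P p.2] i = total_coef t i.
Proof.
move=> Pi; rewrite /total_coef big_filter_cond; apply: eq_bigl => p.
by apply/andP/idP => [[]|/eqP pi] //; rewrite pi eqxx.
Qed.

Lemma is_basis_lincomb (V : lmodType A) (e : I -> V) :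
    (forall v, exists t, v = lincomb e t) ->
    (forall t, lincomb e t = 0 -> forall i, total_coef t i = 0) ->
  is_basis e.
Proof.
move=> span_e free_e; split=> [v | s a Us s0 i si].
  by have [t ->] := span_e v; apply/span_lincomb; exists t.
rewrite -(total_coef_seq a Us si); apply: free_e.
by rewrite /lincomb big_map.
Qed.

End TotalCoef.

(** * Symbols in the associated graded ring *)

Section Symbols.
Variables (A : comNzRingType) (F : comAlgType A) (FF : filtration F).
Implicit Types (x y : F) (a : A).

Lemma monomial_rees d x : FF d x -> x *: 'X^d \in rees_pred FF.
Proof.
move=> Fx; apply/asboolP => e; rewrite coefZ coefXn.
by have [-> | _] := eqVneq e d; rewrite ?mulr1 // mulr0; apply: fil0.
Qed.

(** The class of [x] in degree [d] of the associated graded ring; it is 0 if [x] is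
    not in [FF d]. *)
Definition symbol d x : assoc_graded FF :=
  \pi_(assoc_graded FF) (insubd (0 : rees FF) (x *: 'X^d)).

Lemma val_monomial d x : FF d x ->
  rees_val (insubd (0 : rees FF) (x *: 'X^d)) = x *: 'X^d.
Proof. by move=> /monomial_rees Fx; rewrite -[LHS]/(val _) insubdK. Qed.

Lemma rees_val_sum (I : Type) (r : seq I) (p : I -> rees FF) :
  rees_val (\sum_(i <- r) p i) = \sum_(i <- r) rees_val (p i).
Proof. exact: (rmorph_sum (val : rees FF -> {poly F})). Qed.

Lemma pi_eq0 (p : rees FF) :
  (\pi_(assoc_graded FF) p = 0) <-> (forall d, fil_pred FF d (rees_val p)`_d).
Proof.
have -> : (\pi_(assoc_graded FF) p = 0) <-> p \in @graded_ideal _ _ FF.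
  have -> : (0 : assoc_graded FF) = \pi_(assoc_graded FF) 0 by rewrite rmorph0.
  rewrite -[p in p \in _]subr0 Quotient.idealrBE; split=> [/eqP //|]; exact: eqP.
by split=> /asboolP.
Qed.

Lemma fil_pred0 d : fil_pred FF d 0.
Proof. by case: d => [|d] //=; apply: fil0. Qed.

Lemma symbol_lin d a x y : FF d x -> FF d y ->
  symbol d (a *: x + y) = a *: symbol d x + symbol d y.
Proof.
move=> Fx Fy; rewrite /symbol.
have -> (z : assoc_graded FF) :
    a *: z = \pi_(assoc_graded FF) (rees_const FF a) * z by [].

rewrite -rmorphM -rmorphD; congr (\pi _); apply: val_inj.
rewrite /= mul_polyC !val_monomial //; last exact: filP.
by rewrite scalerDl scalerA -scalerAl mul1r.
Qed.

Lemma symbol0 d : symbol d 0 = 0.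
Proof.
have := symbol_lin 1 (fil0 FF d) (fil0 FF d).
by rewrite !scale1r addr0 => /eqP; rewrite addrC -subr_eq subrr => /eqP.
Qed.

Lemma symbol_lincomb d (I : choiceType) (e : I -> F) (t : seq (A * I)) :
    (forall p, p \in t -> FF d (e p.2)) ->
  symbol d (lincomb e t) = lincomb (fun i => symbol d (e i)) t.
Proof.
move=> te; suff [_] : FF d (lincomb e t) /\
  symbol d (lincomb e t) = lincomb (fun i => symbol d (e i)) t by [].
elim: t te => [|p t IHt] te.
  by rewrite /lincomb !big_nil symbol0; split=> //; apply: fil0.
have [|Ft tE] := IHt; first by move=> q tq; apply: te; rewrite inE tq orbT.
have Fp := te p (mem_head _ _).
rewrite /lincomb !big_cons -!/(lincomb _ _) symbol_lin // tE; split=> //.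
exact: filP.
Qed.

Lemma symbol_eq0 d x : FF d x -> symbol d x = 0 <-> fil_pred FF d x.
Proof.
move=> Fx; rewrite pi_eq0 val_monomial //; split=> [/(_ d) | xd e].
  by rewrite coefZ coefXn eqxx mulr1.
rewrite coefZ coefXn; have [-> | _] := eqVneq e d; rewrite ?mulr1 // mulr0.
exact: fil_pred0.
Qed.

Lemma symbolM d e x y : FF d x -> FF e y ->
  symbol d x * symbol e y = symbol (d + e) (x * y).
Proof.
move=> Fx Fy; rewrite /symbol -rmorphM; congr (\pi _); apply: val_inj.
rewrite /= !val_monomial //; last exact: filM.
by rewrite exprD -scalerAl -scalerAr scalerA.
Qed.

Lemma symbol1 : symbol 0 1 = 1.
Proof.
rewrite -[RHS](rmorph1 (\pi_(assoc_graded FF))); congr (\pi _).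
apply: val_inj; rewrite /= val_monomial; last exact: fil1.
by rewrite scale1r.
Qed.

Lemma graded_componentP d z :
  graded_component d z <-> exists2 x, FF d x & z = symbol d x.
Proof.
split=> [[p [x [px ->]]] | [x Fx ->]]; last first.
  by exists (insubd (0 : rees FF) (x *: 'X^d)), x; rewrite /= val_monomial.
have Fx : FF d x.
  have /asboolP/(_ d) := reesP p; rewrite -[rees_val p]/(val p) px.
  by rewrite coefZ coefXn eqxx mulr1.
exists x => //; congr (\pi _); apply: val_inj; rewrite px /=.
by rewrite val_monomial.
Qed.

Lemma symbol_decomposition z : exists (N : nat) (x : nat -> F),
  (forall d, FF d (x d)) /\ z = \sum_(d < N) symbol d (x d).
Proof.
rewrite -[z]reprK; set p := repr z.
exists (size (rees_val p)), (fun d => (rees_val p)`_d).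
have Fp d : FF d (rees_val p)`_d by have /asboolP := reesP p.
split=> //; rewrite -rmorph_sum; congr (\pi _); apply: val_inj.
rewrite rmorph_sum /= -[LHS]coefK poly_def.
by apply: eq_bigr => d _; rewrite val_monomial.
Qed.

Lemma sum_symbol_eq0 N (x : nat -> F) : (forall d, FF d (x d)) ->
  \sum_(d < N) symbol d (x d) = 0 -> forall d, (d < N)%N -> fil_pred FF d (x d).
Proof.
move=> Fx; rewrite -rmorph_sum => /pi_eq0 x0 d lt_d.
have := x0 d; rewrite rees_val_sum coef_sum (bigD1 (Ordinal lt_d)) //=.
rewrite val_monomial // coefZ coefXn eqxx mulr1 big1 ?addr0 // => e ed.
rewrite val_monomial // coefZ coefXn; case: eqP => [de|]; rewrite ?mulr0 //.
by case/eqP: ed; apply: val_inj.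
Qed.

End Symbols.

(** * Types of given norm *)

Lemma partition_ofK (p : Defs.partition) : partition_of (val p) = p.
Proof.
apply: val_inj; case: p => s /= /andP[s_sorted s0].
rewrite (all_filterP _); first by apply: sorted_sort => // i j k; lia.
by apply/allP => i; apply: contraTneq => ->.
Qed.

Lemma finite_pnorm_le (gT : finGroupType) d :
  finite_set [set v : pvfun gT | (pnorm v <= d)%N]%classic.
Proof.
pose T := {ffun conj_class gT -> {bseq d of 'I_d.+1}}.
pose g (h : T) : pvfun gT :=
  [ffun c => partition_of [seq val i | i <- h c]].
apply: (@sub_finite_set _ _ (range g)); last first.
  by apply: finite_image; apply: finite_finset.
move=> v /= vd; have le_d c : (sumn (val (v c)) <= d)%N.
  by apply: leq_trans vd; rewrite /pnorm (bigD1 c) //= leq_addr.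
exists [ffun c => insub_bseq d [seq inord i | i <- val (v c)]] => //.
apply/ffunP => c; rewrite !ffunE -[RHS]partition_ofK; congr partition_of.
case: (v c) (le_d c) => s /= /andP[_ s0] sd.
have size_s : (size s <= sumn s)%N.
  elim: s s0 {sd} => //= i s IHs; rewrite inE negb_or => /andP[i0 /IHs].
  by rewrite eq_sym -lt0n in i0; lia.
have -> : bseqval (insub_bseq d [seq inord i | i <- s]) =
    [seq inord i | i <- s] :> seq 'I_d.+1.
  by rewrite -[LHS]/(val _) insubdK // -topredE /= size_map (leq_trans size_s).
rewrite -map_comp.
apply: map_id_in => i si; rewrite /= inordK // ltnS (leq_trans _ sd) //.
by rewrite sumnE (big_rem i) //= leq_addr.
Qed.

Section NormLevels.
Variable gT : finGroupType.

(** The finitely many types of norm [d] *)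
Definition norm_level d : seq (pvfun gT) :=
  fset_set [set v : pvfun gT | pnorm v = d]%classic.

Lemma finite_pnorm_eq d : finite_set [set v : pvfun gT | pnorm v = d]%classic.
Proof.
by apply: sub_finite_set (finite_pnorm_le gT d) => v /= ->.
Qed.

Lemma mem_norm_level d v : (v \in norm_level d) = (pnorm v == d).
Proof.
rewrite /norm_level in_fset_set; last exact: finite_pnorm_eq.
by apply/idP/eqP; rewrite inE.
Qed.

Lemma fsbig_norm_level d (V : zmodType) (f : pvfun gT -> V) :
  \sum_(v \in [set v : pvfun gT | pnorm v = d]%classic) f v =
  \sum_(v <- norm_level d) f v.
Proof. by rewrite fsbig_finite //; apply: finite_pnorm_eq. Qed.

(** The empty type *)
Definition empty_type : pvfun gT := [ffun=> partition_of [::]].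

Lemma pnorm_eq0 v : (pnorm v == 0%N) = (v == empty_type).
Proof.
rewrite /pnorm sum_nat_eq0; apply/fintype.forallP/eqP => [v0 | -> c].
  apply/ffunP => c; rewrite ffunE; apply: val_inj.
  have := v0 c; case: (v c) => s /= /andP[_]; case: s => //= i s.
  by rewrite inE negb_or eq_sym -lt0n addn_eq0 => /andP[/lt0n_neq0/negbTE ->].
by rewrite ffunE.
Qed.

End NormLevels.

(** * The graded Farahat-Higman ring *)

Section GradedFarahatHigman.
Variables (gT : finGroupType) (F : comAlgType int_poly) (K : pvfun gT -> F).
Variables (FF : filtration F) (F_ring : is_FH_ring K).
Variable F_filtered : is_FH_filtration K FF.
Implicit Types l m v : pvfun gT.

Lemma fil_lincombP d x : FF d x <->
  exists2 t, (forall p, p \in t -> (pnorm p.2 <= d)%N) & x = lincomb K t.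
Proof.
rewrite F_filtered.
exact: (span_lincomb K [set l | (pnorm l <= d)%N]%classic).
Qed.

Lemma fil_pred_lincombP d x : fil_pred FF d x <->
  exists2 t, (forall p, p \in t -> (pnorm p.2 < d)%N) & x = lincomb K t.
Proof.
case: d => [|d] /=; last exact: fil_lincombP.
split=> [-> | [[|p t] tE ->]]; first by exists [::]; rewrite // /lincomb big_nil.
  by rewrite /lincomb big_nil.
by have := tE p (mem_head _ _).
Qed.

Lemma fil_lincomb d t : (forall p, p \in t -> (pnorm p.2 <= d)%N) ->
  FF d (lincomb K t).
Proof. by move=> td; apply/fil_lincombP; exists t. Qed.

Lemma fil_basis d l : (pnorm l <= d)%N -> FF d (K l).
Proof.
move=> ld; have -> : K l = lincomb K [:: (1, l)].
  by rewrite /lincomb big_seq1 scale1r.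
by apply: fil_lincomb => p; rewrite inE => /eqP ->.
Qed.

(** The image of the basis element [K l] in the associated graded ring *)
Definition top_symbol l : assoc_graded FF := symbol FF (pnorm l) (K l).

Lemma symbol_basis d l : (pnorm l <= d)%N ->
  symbol FF d (K l) = if pnorm l == d then top_symbol l else 0.
Proof.
move=> ld; case: eqP => [<- // | /eqP ld'].
apply/symbol_eq0; first exact: fil_basis.
apply/fil_pred_lincombP; exists [:: (1, l)].
  by move=> p; rewrite inE => /eqP -> /=; rewrite ltn_neqAle ld'.
by rewrite /lincomb big_seq1 scale1r.
Qed.

Lemma symbol_lincomb_basis d t : (forall p, p \in t -> (pnorm p.2 <= d)%N) ->
  symbol FF d (lincomb K t) = lincomb top_symbol [seq p <- t | pnorm p.2 == d].
Proof.
move=> td; rewrite symbol_lincomb => [|p /td]; last exact: fil_basis.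
rewrite /lincomb big_filter big_mkcond [RHS]big_mkcond /=.
rewrite big_seq [RHS]big_seq; apply: eq_bigr => p /td pd.
by rewrite symbol_basis //; case: ifP => // _; rewrite scaler0.
Qed.

Lemma top_symbol_span z : exists t, z = lincomb top_symbol t.
Proof.
have [N [x [Fx ->]]] := symbol_decomposition z.
elim/big_rec: _ => [|d y _ [t ->]].
  by exists [::]; rewrite /lincomb big_nil.
have /fil_lincombP[s sd ->] := Fx d.
exists ([seq p <- s | pnorm p.2 == d] ++ t).
by rewrite symbol_lincomb_basis // lincomb_cat.
Qed.

Lemma top_symbol_basis : is_basis top_symbol.
Proof.
apply: is_basis_lincomb => [|t t0 i]; first exact: top_symbol_span.
pose part d := [seq p <- t | pnorm p.2 == d].
have part_le d p : p \in part d -> (pnorm p.2 <= d)%N.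
  by rewrite mem_filter => /andP[/eqP ->].
pose N := (\max_(p <- t) pnorm p.2).+1.
have ltN p : p \in t -> (pnorm p.2 < N)%N.
  by move=> tp; rewrite ltnS (big_rem p) //= leq_maxl.
have [iN | iN] := ltnP (pnorm i) N; last first.
  apply: total_coef_notin => p /ltN; apply: contraTneq => ->.
  by rewrite -leqNgt.
have sum0 : \sum_(d < N) symbol FF d (lincomb K (part d)) = 0.
  rewrite -[RHS]t0; under eq_bigr => d _.
    rewrite symbol_lincomb_basis ?filter_id; last exact: part_le.
    rewrite /lincomb big_filter; over.
  rewrite (exchange_big_dep xpredT) //= [RHS]big_seq [LHS]big_seq.
  apply: eq_bigr => p /ltN lt_p; by rewrite (big_pred1 (Ordinal lt_p)).
have Fpart d : FF d (lincomb K (part d)) by apply/fil_lincomb/part_le.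
(* The part of [t] of norm [pnorm i] lies one step lower in the filtration, hence is
   a combination of basis elements of smaller norm. *)
have /fil_pred_lincombP[s s_lt part_s] := sum_symbol_eq0 Fpart sum0 iN.
have := basis_lincomb0 F_ring.1
  (t := part (pnorm i) ++ [seq (-1 * p.1, p.2) | p <- s]).
move=> /(_ _ i) <-; last by rewrite lincomb_cat lincombZ part_s scaleN1r subrr.
rewrite total_coef_cat /part.
rewrite (total_coef_filter (P := fun v => pnorm v == pnorm i)) //.
rewrite [X in _ + X]total_coef_notin.
  by rewrite addr0.
by move=> _ /mapP[p /s_lt + ->] /=; apply: contraTneq => ->; rewrite ltnn.
Qed.

Lemma top_symbolM l m : top_symbol l * top_symbol m =
  \sum_(v <- norm_level gT (pnorm l + pnorm m))
     (top_coef l m v)%:R *: top_symbol v.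
Proof.
rewrite symbolM; try exact: fil_basis.
have finD := finite_pnorm_le gT (pnorm l + pnorm m).
rewrite F_ring.2 fsbig_finite //=; set D := [set v | _]%classic.
have -> : \sum_(v <- fset_set D) struct_poly l m v *: K v =
    lincomb K [seq (struct_poly l m v, v) | v <- fset_set D].
  by rewrite /lincomb big_map.
rewrite symbol_lincomb_basis; last first.
  by move=> _ /mapP[v + ->]; rewrite in_fset_set // inE.
rewrite /lincomb big_filter big_map /= -big_filter.
rewrite (perm_big (norm_level gT (pnorm l + pnorm m))) /=.
  rewrite big_seq [RHS]big_seq; apply: eq_bigr => v.
  by rewrite mem_norm_level => /eqP /top_coefP ->.
apply: uniq_perm; rewrite ?filter_uniq ?fset_uniq // => v.
rewrite mem_filter mem_norm_level; case: eqP => //= vlm.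
by rewrite in_fset_set //; apply/mem_set; rewrite /D /= vlm.
Qed.

Lemma graded_component_lincombP d z : graded_component d z <->
  exists2 t, (forall p, p \in t -> pnorm p.2 = d) & z = lincomb top_symbol t.
Proof.
rewrite graded_componentP; split=> [[x /fil_lincombP[t td ->] ->] | [t td ->]].
  exists [seq p <- t | pnorm p.2 == d]; last exact: symbol_lincomb_basis.
  by move=> p; rewrite mem_filter => /andP[/eqP].
have td' p : p \in t -> (pnorm p.2 <= d)%N by move=> /td ->.
exists (lincomb K t); first exact: fil_lincomb.
rewrite symbol_lincomb_basis //; congr lincomb; apply/esym/all_filterP/allP.
by move=> p /td ->.
Qed.

(** The unit of the Farahat-Higman ring is the basis element of the empty type. As 1
    has degree 0 it is a multiple [a *: K empty_type], and [a] is inverse to a natural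
    number, the structure constant of [K empty_type * K empty_type]. *)
Lemma FH_basis0 : K (empty_type gT) = 1.
Proof.
have /fil_lincombP[t t0 tE] := fil1 FF.
have t_empty p : p \in t -> p.2 = empty_type gT.
  by move=> /t0; rewrite leqn0 pnorm_eq0 => /eqP.
have pnorm0 : pnorm (empty_type gT) = 0%N by apply/eqP; rewrite pnorm_eq0.
pose a := \sum_(p <- t) p.1.
have aE : 1 = a *: K (empty_type gT).
  rewrite tE /lincomb /a scaler_suml big_seq [RHS]big_seq.
  by apply: eq_bigr => p /t_empty ->.
pose s := top_coef (empty_type gT) (empty_type gT) (empty_type gT).
have KK : K (empty_type gT) * K (empty_type gT) = s%:R *: K (empty_type gT).
  rewrite F_ring.2 pnorm0 -top_coefP ?pnorm0 //.
  have -> : [set v : pvfun gT | (pnorm v <= 0 + 0)%N]%classic =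
      [set empty_type gT]%classic.
    apply/seteqP; split=> v /=; last by move=> ->; rewrite pnorm0.
    by rewrite leqn0 pnorm_eq0 => /eqP.
  by rewrite fsbig_set1.
have as1 : a * s%:R = 1.
  apply/eqP; rewrite -subr_eq0; apply/eqP.
  have := basis_lincomb0 F_ring.1 (t := [:: (a * s%:R - 1, empty_type gT)]).
  move=> /(_ _ (empty_type gT)); rewrite /total_coef /lincomb !big_cons !big_nil /=.
  rewrite eqxx !addr0; apply.
  by rewrite scalerBl scale1r -scalerA -KK scalerAl -aE mul1r subrr.
have valM := rmorphM (val : int_poly -> {poly rat}).
have val_nat := rmorph_nat (val : int_poly -> {poly rat}).
have val1 := rmorph1 (val : int_poly -> {poly rat}).
have as0 : (a : {poly rat}).[0] * s%:R = 1.
  transitivity ((val (a * s%:R) : {poly rat}).[0]).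
    rewrite valM hornerM; congr (_ * _).
    by rewrite val_nat -polyC_natr hornerC.
  by rewrite as1 val1 hornerC.
have /asboolP/(_ 0)/intrP[k ak] := int_polyP a.
rewrite ak in as0; move: as0.
rewrite (pmulrn _ s) -intrM => /eqP.
rewrite -[X in _ == X]/(1%:~R) eqr_int => /eqP ks.
have s1 : s = 1%N.
  have /(congr1 absz) := ks; rewrite abszM /= => /eqP.
  by rewrite muln_eq1 => /andP[_ /eqP].
by rewrite s1 mulr1 in as1; rewrite aE as1 scale1r.
Qed.

Lemma top_symbol0 : top_symbol (empty_type gT) = 1.
Proof.
have pnorm0 : pnorm (empty_type gT) = 0%N by apply/eqP; rewrite pnorm_eq0.
by rewrite /top_symbol pnorm0 FH_basis0 symbol1.
Qed.

End GradedFarahatHigman.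

Section SubringAlgebra.
Variables (S : comNzRingType) (P : subringClosed S).

(** A subring of a commutative ring, as an algebra over the integers *)
Record subring_of :=
  SubringOf { subring_val : S; subring_valP : subring_val \in P }.
HB.instance Definition _ := [isSub for subring_val].
HB.instance Definition _ := [Choice of subring_of by <:].
HB.instance Definition _ := [SubChoice_isSubComNzRing of subring_of by <:].

Definition subring_scale (a : int) (x : subring_of) : subring_of := x *~ a.

Lemma subring_scaleA a b x :
  subring_scale a (subring_scale b x) = subring_scale (a * b) x.
Proof. by rewrite /subring_scale -mulrzA mulrC. Qed.

Lemma subring_scale1 : left_id 1 subring_scale.
Proof. exact: mulr1z. Qed.

Lemma subring_scaleDr : right_distributive subring_scale +%R.
Proof. by move=> a x y; apply: mulrzDl. Qed.

Lemma subring_scaleDl x : {morph subring_scale^~ x : a b / a + b}.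
Proof. by move=> a b; apply: mulrzDr. Qed.

HB.instance Definition _ := GRing.Zmodule_isLmodule.Build int subring_of
  subring_scaleA subring_scale1 subring_scaleDr subring_scaleDl.

Lemma subring_scaleAl a (x y : subring_of) : a *: (x * y) = (a *: x) * y.
Proof. by rewrite -[LHS]/((x * y) *~ a) -mulrzAl. Qed.

HB.instance Definition _ :=
  GRing.Lmodule_isLalgebra.Build int subring_of subring_scaleAl.
HB.instance Definition _ := GRing.Lalgebra_isComAlgebra.Build int subring_of.

Lemma subring_valZ a (x : subring_of) :
  subring_val (a *: x) = subring_val x *~ a.
Proof. exact: (raddfMz (val : subring_of -> S)). Qed.

Lemma subring_val_sum (I : Type) (r : seq I) (x : I -> subring_of) :
  subring_val (\sum_(i <- r) x i) = \sum_(i <- r) subring_val (x i).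
Proof. exact: (raddf_sum (val : subring_of -> S)). Qed.

End SubringAlgebra.

Lemma int_poly_intr_inj (a : int) : a%:~R = 0 :> int_poly -> a = 0.
Proof.
move=> /(congr1 (val : int_poly -> {poly rat})).
rewrite (rmorph_int (val : int_poly -> {poly rat})) rmorph0.
by rewrite -(rmorph_int polyC) => /eqP; rewrite polyC_eq0 intr_eq0 => /eqP.
Qed.

Lemma scale_intE (V : lmodType int) (a : int) (v : V) : a *: v = v *~ a.
Proof. by rewrite -scaler_int intz. Qed.

Section IntegralForm.
Variables (gT : finGroupType) (F : comAlgType int_poly) (K : pvfun gT -> F).
Variables (FF : filtration F) (F_ring : is_FH_ring K).
Variable F_filtered : is_FH_filtration K FF.
Local Notation top := (top_symbol K FF).

(** The integral linear combinations of the [top_symbol K FF l] *)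
Definition integral_span : {pred assoc_graded FF} :=
  [pred z : assoc_graded FF | `[< exists t : seq (int * pvfun gT),
     z = \sum_(p <- t) top p.2 *~ p.1 >]].

Lemma integral_span_subring : subring_closed integral_span.
Proof.
have span1 l a : top l *~ a \in integral_span.
  by apply/asboolP; exists [:: (a, l)]; rewrite big_seq1.
have spanB : {in integral_span &, forall x y, x - y \in integral_span}.
  move=> _ _ /asboolP[s ->] /asboolP[t ->]; apply/asboolP.
  exists (s ++ [seq (- p.1, p.2) | p <- t]).
  rewrite big_cat big_map /= -sumrN; congr (_ + _).
  by apply: eq_bigr => p _; rewrite mulrNz.
have span0 : 0 \in integral_span by apply/asboolP; exists [::]; rewrite big_nil.
have spanD : {in integral_span &, forall x y, x + y \in integral_span}.
  move=> x y xS yS; rewrite -[y]opprK -[- y]add0r; apply: (spanB) => //.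
  exact: spanB.
have sumS (I : eqType) (r : seq I) (f : I -> assoc_graded FF) :
    (forall i, f i \in integral_span) -> \sum_(i <- r) f i \in integral_span.
  by move=> fS; elim/big_rec: _ => // i x _; apply: spanD.
split; first by rewrite -(top_symbol0 F_ring F_filtered) -[top_symbol _ _ _]mulr1z.
  exact: spanB.
move=> _ _ /asboolP[s ->] /asboolP[t ->].
rewrite mulr_suml; apply: (sumS) => p; rewrite mulr_sumr; apply: (sumS) => q.
rewrite mulrzAl mulrzAr (top_symbolM F_ring F_filtered).
rewrite -mulrzA mulrz_suml; apply: (sumS) => v.
by rewrite scaler_nat pmulrn -mulrzA.
Qed.

End IntegralForm.

Section Isomorphism.
Variables (gT : finGroupType) (F : comAlgType int_poly) (K : pvfun gT -> F).
Variables (FF : filtration F) (F_ring : is_FH_ring K).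
Variable F_filtered : is_FH_filtration K FF.
Local Notation top := (top_symbol K FF).

(** The integral span of the symbols in the associated graded ring is a ring with the
    required basis and structure constants. *)
Lemma graded_FH_ring_exists :
  exists (G : algType int) (KG : pvfun gT -> G), is_graded_FH_ring KG.
Proof.
pose P : subringClosed (assoc_graded FF) := HB.pack (@integral_span _ _ K FF)
  (GRing.isSubringClosed.Build (assoc_graded FF) (@integral_span _ _ K FF)
     (integral_span_subring F_ring F_filtered)).
have topP l : top l \in P.
  by apply/asboolP; exists [:: (1, l)]; rewrite big_seq1.
pose KG l : subring_of P := SubringOf (topP l).
have valE t : subring_val (lincomb KG t) =
    lincomb top [seq (p.1%:~R, p.2) | p <- t].
  rewrite /lincomb big_map /= subring_val_sum.
  by apply: eq_bigr => p _; rewrite subring_valZ scaler_int.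
exists (subring_of P : algType int), KG; split.
  apply: is_basis_lincomb => [x | t t0 i].
    have /asboolP[t tE] := subring_valP x; exists t; apply: val_inj.
    rewrite /= valE tE /lincomb big_map.
    by apply: eq_bigr => p _; rewrite scaler_int.
  apply: int_poly_intr_inj.
  have := congr1 (@subring_val _ P) t0; rewrite valE.
  move=> /(basis_lincomb0 (top_symbol_basis F_ring F_filtered))/(_ i) <-.
  by rewrite /total_coef big_map rmorph_sum.
move=> l m; rewrite fsbig_norm_level; apply: val_inj.
rewrite /= (top_symbolM F_ring F_filtered).
rewrite subring_val_sum.
by apply: eq_bigr => v _; rewrite subring_valZ scaler_nat.
Qed.

Variables (G : algType int) (KG : pvfun gT -> G) (G_ring : is_graded_FH_ring KG).
Variables (T : algType int_poly) (tau : int_poly -> G -> T).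
Hypothesis T_tensor : is_tensor_ring tau.

Lemma tensor_unit_additive : zmod_morphism (tau 1).
Proof.
have tauD := tensorDr T_tensor 1.
have tau0 : tau 1 0 = 0 by apply: (addIr (tau 1 0)); rewrite -tauD !add0r.
move=> x y; apply: (addIr (tau 1 y)).
by rewrite -tauD !subrK.
Qed.

Lemma tensor_scale a g : tau a g = a *: tau 1 g.
Proof. by rewrite (tensorZ T_tensor) mulr1. Qed.

(** The inverse is given by the universal property of the tensor product. As the
    map is multiplicative and onto, it preserves the unit. *)
Lemma graded_isomorphism : exists phi : {lrmorphism assoc_graded FF -> T},
  bijective phi /\ forall l, phi (top l) = tau 1 (KG l).
Proof.
have Btop := top_symbol_basis F_ring F_filtered.
have [phi phiE] := basis_extend (fun l => tau 1 (KG l)) Btop.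
have phiZ a z : phi (a *: z) = a *: phi z by exact: linearZ.
pose tau1 : {additive G -> T} :=
  HB.pack (tau 1) (GRing.isZmodMorphism.Build G T (tau 1) tensor_unit_additive).
have [theta thetaE] :=
  @basis_extend _ _ G (zmodule (assoc_graded FF)) KG top G_ring.1.
have phi_theta g : phi (theta g) = tau1 g.
  have [t ->] := basis_spanP g G_ring.1.
  rewrite !raddf_sum; apply: eq_bigr => p _.
  by rewrite !scale_intE !raddfMz /= thetaE phiE.
have [psi [psiE _]] := @tensor_universal _ _ _ _ T_tensor (assoc_graded FF)
  (fun a g => a *: (theta g : assoc_graded FF))
  (fun g a b => scalerDl _ a b)
  (fun a g h => etrans
     (congr1 (fun z : assoc_graded FF => a *: z) (raddfD theta g h))
     (scalerDr a _ _)).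
have psi_phi : cancel phi psi.
  move=> z; have [t ->] := basis_spanP z Btop.
  rewrite !raddf_sum; apply: eq_bigr => p _.
  by rewrite /= phiZ phiE -tensor_scale psiE thetaE.
have phi_psi : cancel psi phi.
  have [h [_ h_uniq]] := @tensor_universal _ _ _ _ T_tensor T tau
    (tensorDl T_tensor) (tensorDr T_tensor).
  pose phipsi : {additive T -> T} := [the {additive T -> T} of phi \o psi].
  move=> y; rewrite -[LHS]/(phipsi y) -[RHS]/(idfun y) (h_uniq phipsi).
    by rewrite (h_uniq [the {additive T -> T} of idfun]).
  by move=> a g; rewrite /= psiE phiZ phi_theta -tensor_scale.
have phiM_top l m : phi (top l * top m) = phi (top l) * phi (top m).
  rewrite !phiE (tensorM T_tensor) mulr1 G_ring.2 fsbig_norm_level.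
  rewrite (top_symbolM F_ring F_filtered) -[RHS]/(tau1 _) !raddf_sum.
  apply: eq_bigr => v _; rewrite /= phiZ phiE scaler_nat scale_intE.
  by rewrite -[RHS]/(tau1 _) raddfMz -pmulrn.
have phiM x y : phi (x * y) = phi x * phi y.
  have [s ->] := basis_spanP x Btop; have [t ->] := basis_spanP y Btop.
  rewrite mulr_suml !raddf_sum mulr_suml; apply: eq_bigr => p _.
  rewrite !mulr_sumr raddf_sum; apply: eq_bigr => q _.
  rewrite /= -scalerAl -scalerAr !phiZ phiM_top.
  by rewrite -scalerAl -scalerAr.
have phi1 : phi 1 = 1.
  by rewrite -[LHS]mulr1 -[X in _ * X = _]phi_psi -phiM mul1r phi_psi.
have phi_mon : GRing.monoid_morphism phi by split.
pose Phi : {lrmorphism assoc_graded FF -> T} :=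
  HB.pack (phi : assoc_graded FF -> T) (GRing.Linear.class phi)
    (GRing.isMonoidMorphism.Build (assoc_graded FF) T phi phi_mon).
by exists Phi; split; first by exists psi.
Qed.

Lemma graded_isomorphism_component (phi : {lrmorphism assoc_graded FF -> T}) :
    bijective phi -> (forall l, phi (top l) = tau 1 (KG l)) ->
  forall d x, graded_component d x <-> tensor_component KG tau d (phi x).
Proof.
move=> phi_bij phiE d x.
split=> [/(graded_component_lincombP F_filtered)[t td ->] | ].
  exists [seq (p.1, tau 1 (KG p.2)) | p <- t]; split.
    move=> _ /mapP[p /td pd ->]; exists 1, (KG p.2); split=> //.
    apply/(span_lincomb KG [set l | pnorm l = d]%classic).
    exists [:: (1, p.2)]; last by rewrite /lincomb big_seq1 scale1r.
    by move=> q; rewrite inE => /eqP ->.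
  rewrite big_map raddf_sum; apply: eq_bigr => p _.
  by rewrite /= linearZ /= phiE.
move=> [s [sd sE]].
pose tau1 : {additive G -> T} :=
  HB.pack (tau 1) (GRing.isZmodMorphism.Build G T (tau 1) tensor_unit_additive).
suff [t td tE] : exists2 t, (forall p, p \in t -> pnorm p.2 = d)
    & \sum_(ax <- s) ax.1 *: ax.2 = phi (lincomb top t).
  apply/(graded_component_lincombP F_filtered); exists t => //.
  by apply: (bij_inj phi_bij); rewrite sE.
elim: s sd {sE} => [|[a y] s IHs] sd.
  by exists [::]; rewrite // /lincomb !big_nil raddf0.
rewrite big_cons; have [|t td ->] := IHs.
  by move=> p ps; apply: sd; rewrite inE ps orbT.
have [b [g [gd /= ->]]] := sd (a, y) (mem_head _ _).
have /(span_lincomb KG [set l | pnorm l = d]%classic)[u ud ->] := gd.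
exists ([seq (a * b * p.1%:~R, p.2) | p <- u] ++ t).
  by move=> p; rewrite mem_cat => /orP[/mapP[q /ud qd ->] | /td].
rewrite lincomb_cat raddfD /=; congr (_ + _).
rewrite tensor_scale scalerA -[tau 1 _]/(tau1 _) /lincomb big_map !raddf_sum.
apply: eq_bigr => p _.
rewrite /= linearZ /= -[in RHS]scalerA phiE scaler_int scale_intE.
by rewrite -[tau 1 _]/(tau1 _) raddfMz.
Qed.

End Isomorphism.

Theorem theorem2p16 (gT : finGroupType)
    (F : comAlgType int_poly) (K : pvfun gT -> F) (FF : filtration F)
    (F_ring : is_FH_ring K) (F_filtered : is_FH_filtration K FF) :
  (exists (G : algType int) (KG : pvfun gT -> G), is_graded_FH_ring KG) /\
  (forall (G : algType int) (KG : pvfun gT -> G), is_graded_FH_ring KG ->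
   forall (T : algType int_poly) (tau : int_poly -> G -> T),
     is_tensor_ring tau ->
   exists phi : {lrmorphism assoc_graded FF -> T},
     bijective phi /\
     forall (d : nat) (x : assoc_graded FF),
       graded_component d x <-> tensor_component KG tau d (phi x)).
Proof.
split; first exact: graded_FH_ring_exists F_ring F_filtered.
move=> G KG G_ring T tau T_tensor.
have [phi [phi_bij phiE]] :=
  graded_isomorphism F_ring F_filtered G_ring T_tensor.
exists phi; split=> // d x.
exact: (graded_isomorphism_component F_filtered T_tensor phi_bij phiE d x).
Qed.
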